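(* For every fixed integer $\ell\ge 2$, $$f(n,P_{2\ell+1})=4\ell\left(\frac{n}{\ell}\right)^{\ell+1}+O(n^\ell)$$ as $n\to\infty$, where the implied constant may depend on $\ell$.
   Context: All graphs are finite and simple. For graphs $G$ and $H$, $N(G,H)$ denotes the number of unlabeled, not necessarily induced copies of $H$ in $G$ (i.e. the number of subgraphs of $G$ isomorphic to $H$), and $f(n,H)=\max\{N(G,H): |V(G)|=n \text{ and } G \text{ is planar}\}$. $P_k$ denotes the path on $k$ vertices, so $P_{2\ell+1}$ is the path with $2\ell+1$ vertices and $2\ell$ edges. *)

(* Defs.v *)
From HB Require Import structures.
From mathcomp Require Import all_boot all_order all_algebra.
From mathcomp Require Import all_classical all_reals all_analysis.

Set Implicit Arguments.
Unset Strict Implicit.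
Unset Printing Implicit Defensive.

Import Order.TTheory GRing.Theory Num.Theory.
Import numFieldNormedType.Exports.

Local Open Scope classical_set_scope.
Local Open Scope ring_scope.

Record graph (V : finType) := Graph {
  edges : {set {set V}};
  edges_card2 : [forall e in edges, #|e| == 2]
}.

HB.instance Definition _ (V : finType) := [isSub for @edges V].
HB.instance Definition _ (V : finType) := [Countable of graph V by <:].
HB.instance Definition _ (V : finType) := [Finite of graph V by <:].

(* A subgraph is a pair (vertex set, edge set).  It is a copy of H when some
   bijection from the vertices of H onto its vertex set carries the edges of H
   exactly onto its edge set. *)
Definition is_subgraph (V : finType) (G : graph V)
    (S : {set V} * {set {set V}}) : bool :=
  (S.2 \subset edges G) && [forall e in S.2, e \subset S.1].

Definition is_copy (V W : finType) (H : graph W)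
    (S : {set V} * {set {set V}}) : bool :=
  [exists f : {ffun W -> V},
    [&& injectiveb f,
        (f @: [set: W])%SET == S.1 &
        [set f @: e | e : {set W} in edges H]%SET == S.2]].

Definition num_copies (V W : finType) (G : graph V) (H : graph W) : nat :=
  #|[set S | is_subgraph G S && is_copy H S]%SET|.

Definition path_edges (k : nat) : {set {set 'I_k}} :=
  [set e | [exists i : 'I_k, exists j : 'I_k,
              (j == i.+1 :> nat) && (e == [set i; j]%SET)]]%SET.

Fact path_edges_card2 (k : nat) : [forall e in path_edges k, #|e| == 2].
Proof.
apply/forall_inP => e; rewrite inE => /existsP[i /existsP[j /andP[/eqP ji]]].
move=> /eqP ->; rewrite cards2; suff -> : i != j by [].
by apply: contra_eq_neq ji => ->; rewrite ltn_eqF.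
Qed.

Definition path_graph (k : nat) : graph 'I_k := Graph (path_edges_card2 k).

(* A plane drawing: p places the vertices and, for each edge e, gamma e
   restricted to [0, 1] parametrizes a simple arc joining the two ends of e.
   The interior of an arc contains no vertex and no point of another arc. *)
Record is_plane_drawing (R : realType) (V : finType) (G : graph V)
    (p : V -> R * R) (gamma : {set V} -> R -> R * R) : Prop := IsPlaneDrawing {
  drawing_vertices_inj : injective p;
  drawing_continuous : forall e : {set V}, e \in edges G ->
    {within `[0, 1], continuous (gamma e)};
  drawing_arc_inj : forall e : {set V}, e \in edges G ->
    {in `[0, 1] &, injective (gamma e)};
  drawing_ends : forall e : {set V}, e \in edges G ->
    [set gamma e 0; gamma e 1] = p @` [set` e];
  drawing_avoids_vertices : forall (e : {set V}) (v : V) (t : R),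
    e \in edges G -> t \in `]0, 1[ -> gamma e t <> p v;
  drawing_no_crossing : forall (e e' : {set V}) (s t : R),
    e \in edges G -> e' \in edges G -> e != e' ->
    s \in `]0, 1[ -> t \in `[0, 1] -> gamma e s <> gamma e' t
}.

Definition planar (R : realType) (V : finType) (G : graph V) : Prop :=
  exists p gamma, @is_plane_drawing R V G p gamma.

Definition max_planar_copies (R : realType) (n : nat) (W : finType)
    (H : graph W) : nat :=
  \max_(G : graph 'I_n | `[< planar R G >]) num_copies G H.

(* Main.v *)
Require Import Defs.
From mathcomp Require Import all_boot all_order all_algebra.
From mathcomp Require Import all_classical all_reals all_analysis.
From mathcomp Require Import ring lra zify.

(** Why the theorem is true.

    Lower bound.  Replace every other vertex of a cycle of length 2l by about
    n / l twins.  The l untouched vertices are called hubs, the twins leaves.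
    The resulting graph is planar.  A path that starts and ends in leaves and
    visits all hubs in cyclic order is determined by its first hub (l choices,
    the direction being accounted for by reversal), by the l - 1 inner leaves
    (n / l choices each) and by the two outer leaves (2n / l choices each), up
    to O(n^l) coincidences.  This gives 4 l (n / l)^(l+1) paths
    ([blowup_planar], [num_copies_blowup]).

    Upper bound.  Planarity enters only through the absence of a K33 minor
    ([drawing_no_K33]).  It implies that three vertices have at most two common
    neighbours ([common_nbrs_le2]) and that the vertices can be ranked so that
    each has at most 127 neighbours of larger rank ([degenerate_rank]).
    Consider the walks v_0 ... v_2l.

    - If some v_2i has a neighbour of smaller rank on the walk, then v_2i is
      one of boundedly many vertices once the rest is known, and the rest is
      perfectly matched by edges of the walk.  As there are O(n) edges, there
      are O(n^l) such walks ([count_descends]).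
    - Otherwise every vertex v in odd position is entered from two neighbours
      of smaller rank.  If d(v) of its neighbours have smaller rank, the same
      matching argument leaves at most d(v)^2 O(n^(l-1)) walks through v in a
      given position ([count_avoids]).
    - Call hubs the vertices of degree more than n / q, for a constant q; there
      are O(q) of them.  The walks whose odd positions are all hubs are counted
      by the sum over b_1 ... b_l of deg b_1, the common degrees of consecutive
      hubs, and deg b_l ([count_sorted_odds]).

    The last sum is bounded by a sharp inequality for arbitrary weights mu on
    the pairs of a finite set ([path_weight_sum]): when the total weight is M,
    the sum over the ordered paths b_1 ... b_l of
    d(b_1) mu(b_1 b_2) ... mu(b_(l-1) b_l) d(b_l) is at most 8 l (M / l)^(l+1).
    For the proof, let f_i be the weight from b_i to the vertices outside
    b_1 ... b_i, and g_i the weight from b_i to those outside b_i ... b_l.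
    Choosing b_1 with probability d(b_1) / 2M and then each b_(i+1) with
    probability mu(b_i b_(i+1)) / f_i defines a law Q on paths, and the same
    from the other end, with the g_i, a law Q'.  The summand equals
    Q 2M d(b_l) prod f_i and also Q' 2M d(b_1) prod g_i, so it is at most the
    mean of Q and Q' times the geometric mean of the two cofactors.  As the f_i
    count disjoint sets of pairs, they sum to at most M, and likewise the g_i;
    the inequality between arithmetic and geometric means then bounds the
    cofactors, and the laws have total mass at most one.

    What makes the error O(n^l) is that the second kind of walk is paid for by
    the third.  Let u be the number of vertices with at most one neighbour
    among the hubs (strays).  Strays do not contribute to the weights of pairs,
    so the third kind loses a multiple of u n^l.  By the condition on common
    neighbours, all but O(1) of the neighbours of a vertex v that is not a hub
    are strays, so that the sum of the d(v)^2 is at most O(u n / q) + O(n), and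
    the second kind gains at most O(u n^l / q) + O(n^l).  For large q the loss
    outweighs the gain ([walk_count_upper]). *)

Set Implicit Arguments.
Unset Strict Implicit.
Unset Printing Implicit Defensive.
Import Order.TTheory GRing.Theory Num.Theory.
Import numFieldNormedType.Exports.
Local Open Scope ring_scope.

(** * Sums over lists of fixed length *)

Section ListSum.
Variables (T : finType) (M : nmodType).

(** Splitting off elements at either end of the lists is a conversion or a short
    induction here, whereas it needs reindexing for sums over tuples. *)
Fixpoint lsum (k : nat) (F : seq T -> M) : M :=
  if k is k'.+1 then \sum_x lsum k' (fun s => F (x :: s)) else F [::].

Lemma eq_lsum k F G : (forall s, size s = k -> F s = G s) ->
  lsum k F = lsum k G.
Proof.
elim: k F G => [|k IH] F G FG /=; first exact: FG.
by apply: eq_bigr => x _; apply: IH => s sk; apply: FG; rewrite /= sk.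
Qed.

Lemma lsum_cat a b F :
  lsum (a + b) F = lsum a (fun s => lsum b (fun t => F (s ++ t))).
Proof. by elim: a F => [|a IH] F //=; apply: eq_bigr => x _; apply: IH. Qed.

Lemma lsumD k F G : lsum k (fun s => F s + G s) = lsum k F + lsum k G.
Proof.
by elim: k F G => [|k IH] F G //=; rewrite -big_split; apply: eq_bigr => x _.
Qed.

Lemma lsum_sum k (I : finType) (P : pred I) (F : I -> seq T -> M) :
  lsum k (fun s => \sum_(i | P i) F i s) = \sum_(i | P i) lsum k (F i).
Proof.
elim: k F => [|k IH] F //=.
by rewrite exchange_big; apply: eq_bigr => x _; rewrite IH.
Qed.

Lemma lsumS k F : lsum k.+1 F = \sum_x lsum k (fun s => F (x :: s)).
Proof. by []. Qed.

Lemma lsum_recr k F :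
  lsum k.+1 F = \sum_x lsum k (fun s => F (rcons s x)).
Proof.
rewrite -addn1 lsum_cat -lsum_sum; apply: eq_lsum => s _ /=.
by apply: eq_bigr => x _; rewrite cats1.
Qed.

Lemma lsum_rev k F : lsum k (fun s => F (rev s)) = lsum k F.
Proof.
elim: k F => [|k IH] F //; rewrite lsum_recr /=.
apply: eq_bigr => x _; rewrite -[RHS]IH; apply: eq_lsum => s _.
by rewrite rev_rcons.
Qed.

Lemma lsum_tuple k F : lsum k F = \sum_(t : k.-tuple T) F t.
Proof.
elim: k F => [|k IH] F /=.
  rewrite (bigD1 [tuple]) //= big1 ?addr0 // => t.
  by move=> /eqP[]; rewrite (tuple0 t).
rewrite (eq_bigr _ (fun x _ => IH _)) pair_big /=.
rewrite (reindex (fun p : T * k.-tuple T => [tuple of p.1 :: p.2])) //=.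
exists (fun t : k.+1.-tuple T => (thead t, [tuple of behead t])).
  by move=> [x t] _ /=; congr pair; apply: val_inj.
by move=> t _; rewrite [in RHS](tuple_eta t); apply: val_inj.
Qed.

End ListSum.

Section ListSumNum.
Variables (T : finType) (R : numDomainType).
Implicit Types F G : seq T -> R.

Lemma ler_lsum k F G : (forall s, size s = k -> F s <= G s) ->
  lsum k F <= lsum k G.
Proof.
elim: k F G => [|k IH] F G FG /=; first exact: FG.
by apply: ler_sum => x _; apply: IH => s sk; apply: FG; rewrite /= sk.
Qed.

Lemma lsumZl k c F : lsum k (fun s => c * F s) = c * lsum k F.
Proof.
by elim: k F => [|k IH] F //=; rewrite mulr_sumr; apply: eq_bigr => x _.
Qed.

Lemma lsum_ge0 k F : (forall s, 0 <= F s) -> 0 <= lsum k F.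
Proof.
by elim: k F => [|k IH] F F0 //=; apply: sumr_ge0 => x _; apply: IH.
Qed.

End ListSumNum.

(** * Sharp bound for weighted path sums *)

Section PathWeights.
Variables (R : realFieldType) (T : finType).
Variables (mu : T -> T -> R) (p : T -> R).
Hypothesis mu_ge0 : forall x y, 0 <= mu x y.
Hypothesis muC : forall x y, mu x y = mu y x.
Hypothesis p_ge0 : forall x, 0 <= p x.

Definition weight_deg x := \sum_(y | y != x) mu x y + p x.

(** Along a path, [s] lists the vertices visited so far, with [y] among them. *)
Definition new_weight y (s : seq T) := \sum_(v | v \notin s) mu y v.

(** Paths are listed from their current end backwards: the head of the list is
    the last vertex reached, so that extending a path is a [cons]. *)
Fixpoint chain_weight (s : seq T) : R :=
  if s is x :: s' then
    (if s' is y :: _ then mu y x * chain_weight s' else 1)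
  else 1.

Fixpoint step_weights (s : seq T) : seq R :=
  if s is x :: s' then new_weight x s :: step_weights s' else [::].

(** The law of the random path that starts in [x] with probability
    [weight_deg x / S] and moves to a vertex not yet visited with probability
    proportional to the weight. *)
Definition walk_law (S : R) (s : seq T) : R :=
  if s is x :: s' then
    (uniq s)%:R * weight_deg (last x s') * chain_weight s / (S * \prod_(z <- step_weights s') z)
  else 0.

Lemma new_weight_ge0 y s : 0 <= new_weight y s.
Proof. exact: sumr_ge0. Qed.

Lemma weight_deg_ge0 x : 0 <= weight_deg x.
Proof. by rewrite addr_ge0 ?sumr_ge0. Qed.

Lemma step_weights_ge0 s : all (fun z => 0 <= z) (step_weights s).
Proof. by elim: s => //= x s ->; rewrite new_weight_ge0. Qed.

Lemma prod_step_weights_ge0 s : 0 <= \prod_(z <- step_weights s) z.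
Proof.
elim: s => [|x s IH]; rewrite ?big_nil ?ler01 //= big_cons.
by rewrite mulr_ge0 ?new_weight_ge0.
Qed.

Lemma chain_weight_ge0 s : 0 <= chain_weight s.
Proof.
by elim: s => [|x [|y s] IH] //=; rewrite mulr_ge0.
Qed.

Lemma chain_weight_rcons s x y : chain_weight (rcons (rcons s y) x) =
  chain_weight (rcons s y) * mu x y.
Proof.
elim: s => [|a s IH] /=; first by rewrite mul1r mulr1.
case: s IH => [|b s] /= ->; rewrite !mulrA //.
Qed.

Lemma chain_weight_rev s : chain_weight (rev s) = chain_weight s.
Proof.
elim: s => [|x s IH] //; case: s IH => [|y s] // IH.
rewrite rev_cons; have := IH; rewrite rev_cons => IH'.
by rewrite chain_weight_rcons IH' mulrC muC.
Qed.

Definition pair_total := (\sum_x \sum_(y | y != x) mu x y) / 2.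
Definition single_total := \sum_x p x.

Lemma sum_weight_deg : \sum_x weight_deg x = 2 * pair_total + single_total.
Proof.
rewrite /pair_total /single_total big_split /=; congr (_ + _).
by rewrite mulrC divfK ?pnatr_eq0.
Qed.

(** Summing over the head of the list is summing the probabilities of the next
    step.  They add up to one, or to zero when there is nowhere to go. *)
Lemma walk_law_le1 (S : R) k : 0 < S -> S = \sum_x weight_deg x ->
  lsum k.+1 (walk_law S) <= 1.
Proof.
move=> S0 SE; elim: k => [|k IH].
  rewrite /= (_ : \sum_x _ = \sum_x weight_deg x / S); last first.
    by apply: eq_bigr => x _; rewrite big_nil !(mul1r, mulr1).
  by rewrite -mulr_suml -SE divff ?lt0r_neq0.
apply: le_trans IH; rewrite [leLHS]lsumS -lsum_sum.
apply: ler_lsum => -[|y s] // sk.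
rewrite (eq_bigr (fun x => (uniq (y :: s))%:R * weight_deg (last y s)
   * chain_weight (y :: s) / (S * \prod_(z <- step_weights (y :: s)) z) *
   ((x \notin y :: s)%:R * mu y x))); last first.
  move=> x _.
  have -> : walk_law S [:: x, y & s] =
      ((x \notin y :: s) && uniq (y :: s))%:R * weight_deg (last y s) *
      (mu y x * chain_weight (y :: s)) / (S * \prod_(z <- step_weights (y :: s)) z) by [].
  rewrite -mulnb natrM; ring.
rewrite -mulr_sumr (_ : \sum_x (x \notin _)%:R * _ = new_weight y (y :: s)); last first.
  rewrite /new_weight [RHS]big_mkcond; apply: eq_bigr => x _.
  by case: (x \notin _); rewrite ?mul1r ?mul0r.
rewrite [step_weights _]/= big_cons /walk_law.
have W0 := new_weight_ge0 y (y :: s).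
have A0 : 0 <= (uniq (y :: s))%:R * weight_deg (last y s) * chain_weight (y :: s) :> R.
  by rewrite !mulr_ge0 ?weight_deg_ge0 ?chain_weight_ge0 ?ler0n.
have P0 := prod_step_weights_ge0 s.
set A := _ * chain_weight _ in A0 *; set P := \prod_(_ <- _) _ in P0 *.
move: W0; set W := new_weight _ _ => W0.
have [->|Wn0] := eqVneq W 0; first by rewrite mulr0 divr_ge0 // mulr_ge0 // ltW.
suff -> : A / (S * (W * P)) * W = A / (S * P) by [].
have -> : (S * (W * P))^-1 = W^-1 * (S * P)^-1 by rewrite mulrCA invfM.
set Z := (S * P)^-1.
have -> : A * (W^-1 * Z) * W = (W^-1 * W) * (A * Z) by ring.
by rewrite mulVf // mul1r.

Qed.

(** The weights counted at different steps belong to different pairs: a pair is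
    counted at the earlier of its two vertices. *)
Lemma sum_step_weights s : uniq s -> \sum_(z <- step_weights s) z <= pair_total.
Proof.
suff main : uniq s -> \sum_(z <- step_weights s) z + (\sum_(x | x \notin s) \sum_(y | (y \notin s) && (y != x)) mu x y) / 2 = pair_total.
  move=> us; rewrite -(main us) lerDl divr_ge0 ?ler0n //.
  by apply: sumr_ge0 => x _; apply: sumr_ge0.
elim: s => [_|x s IH] /=; first by rewrite big_nil add0r.
case/andP=> xs us; rewrite -(IH us) big_cons [_ + \sum_(_ <- _) _]addrC -addrA; congr (_ + _).
rewrite [in RHS](bigD1 x) //=.
have E1 : \sum_(y | (y \notin s) && (y != x)) mu x y = new_weight x (x :: s).
  by rewrite /new_weight; apply: eq_bigl => y; rewrite inE negb_or andbC.
have E2 : \sum_(i | (i \notin s) && (i != x)) \sum_(y | (y \notin s) && (y != i)) mu i y =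
   new_weight x (x :: s) + \sum_(i | i \notin x :: s) \sum_(y | (y \notin x :: s) && (y != i)) mu i y.
  rewrite /new_weight -big_split /=; apply: eq_big => y.
    by rewrite inE negb_or andbC.
  case/andP=> ys yx; rewrite (bigD1 x) /=; last by rewrite xs eq_sym.
  rewrite muC; congr (_ + _); apply: eq_bigl => z.
  by rewrite inE negb_or; case: (z \in s); case: (z == x); case: (z == y).
rewrite E1 E2; set a := new_weight _ _; set b := \sum_(_ | _) _; lra.
Qed.

Lemma size_step_weights s : size (step_weights s) = size s.
Proof. by elim: s => //= x s ->. Qed.

Lemma last_step_weights x s z :
  last z (step_weights (x :: s)) = new_weight (last x s) [:: last x s].
Proof. by elim: s x z => [|y s IH] x z //=; rewrite -(IH y z). Qed.

Lemma weight_degE x : weight_deg x = new_weight x [:: x] + p x.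
Proof.
by congr (_ + _); apply: eq_bigl => y; rewrite inE.
Qed.

(** In particular, a path of positive weight has no vanishing step weight, so
    that dividing by the step weights is harmless on such paths. *)
Lemma chain_weight_le_prod x s : uniq (x :: s) ->
  chain_weight (x :: s) <= \prod_(z <- step_weights s) z.
Proof.
elim: s x => [|y s IH] x; first by rewrite big_nil.
move=> /andP[xys uys]; have := IH y uys.
change (chain_weight [:: x, y & s]) with (mu y x * chain_weight (y :: s)).
rewrite [step_weights (_ :: _)]/= big_cons => le1.
apply: ler_pM => //; first exact: chain_weight_ge0.
rewrite /new_weight (bigD1 x) //= lerDl; exact: sumr_ge0.
Qed.

Lemma last_le_sum (xs : seq R) : all (fun z => 0 <= z) xs ->
  last 0 xs <= \sum_(z <- xs) z.
Proof.
case/lastP: xs => [|xs u]; first by rewrite big_nil.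
rewrite last_rcons -cats1 all_cat big_cat big_seq1 /= lerDr => /andP[/allP a _].
by rewrite big_seq; apply: sumr_ge0 => z /a.
Qed.

Lemma prod_le_mean (s : seq R) : all (fun z => 0 <= z) s ->
  \prod_(z <- s) z <= ((\sum_(z <- s) z) / (size s)%:R) ^+ size s.
Proof.
move=> s0; rewrite (big_nth 0) [in leRHS](big_nth 0) !big_mkord.
have := @leif_AGM R 'I_(size s) predT (fun i => nth 0 s i).
rewrite cardT size_enum_ord => H; have := H _ => -[] //.
by move=> i _ /=; apply: (allP s0); rewrite mem_nth.
Qed.

(** In the extremal configuration the inner factors are half as large as the
    two outer ones; doubling them makes all factors equal, which is the case of
    equality. *)
Lemma prod_le_mean_double (xs : seq R) y k : size xs = k.+1 -> 0 <= y ->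
  all (fun z => 0 <= z) xs ->
  2 ^+ k * (y * \prod_(z <- xs) z) <=
  ((y + 2 * (\sum_(z <- xs) z) - last 0 xs) / k.+2%:R) ^+ k.+2.
Proof.
case/lastP: xs => // xs t; rewrite size_rcons => -[sk] y0.
rewrite all_rcons last_rcons => /andP[t0 xs0].
set ys := y :: rcons [seq 2 * z | z <- xs] t.
have sy : size ys = k.+2 by rewrite /= size_rcons size_map sk.
have ys0 : all (fun z => 0 <= z) ys.
  rewrite /= y0 all_rcons t0; apply/allP => _ /mapP[z /(allP xs0) z0 ->].
  by rewrite mulr_ge0.
have := prod_le_mean ys0; rewrite sy; congr (_ <= (_ / _) ^+ _).
  rewrite big_cons -!cats1 !big_cat !big_seq1 big_map /= big_split /=.
  by rewrite big_const_seq count_predT sk iter_mulr_1; ring.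
by rewrite big_cons -!cats1 !big_cat !big_seq1 big_map /= -mulr_sumr; ring.
Qed.

Definition path_weight s :=
  if s is x :: s' then weight_deg x * chain_weight s * weight_deg (last x s') else 0.

Lemma path_weight_ge0 s : 0 <= path_weight s.
Proof. by case: s => // x s; rewrite !mulr_ge0 ?weight_deg_ge0 ?chain_weight_ge0. Qed.

Lemma path_weight_rev s : path_weight (rev s) = path_weight s.
Proof.
case: s => // x s; case/lastP: s => [//|s y].
have E : rev (x :: rcons s y) = y :: rcons (rev s) x.
  by rewrite rev_cons rev_rcons.
rewrite E /path_weight -E chain_weight_rev !last_rcons; ring.
Qed.

(** The quotient of [path_weight] by [walk_law]. *)
Definition step_prod (S : R) (s : seq T) : R :=
  if s is x :: s' then S * (weight_deg x * \prod_(z <- step_weights s') z) else 0.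

Lemma walk_lawE S s : uniq s -> 0 < S -> 0 < path_weight s ->
  0 < step_prod S s /\ walk_law S s = path_weight s / step_prod S s.
Proof.
case: s => [_ _|x s us S0]; first by rewrite ltxx.
rewrite /path_weight /step_prod /walk_law us => w0.
have d0 := weight_deg_ge0 x; have P0 := prod_step_weights_ge0 s.
have := chain_weight_le_prod us; have C0 := chain_weight_ge0 (x :: s).
move: w0 d0 P0 C0; set d := weight_deg x; set P := \prod_(_ <- _) _.
set C := chain_weight _; set e := weight_deg _ => w0 d0 P0 C0 CP.
have d1 : 0 < d by rewrite lt0r d0 andbT; apply: contraTneq w0 => ->; rewrite !mul0r ltxx.
have C1 : 0 < C by rewrite lt0r C0 andbT; apply: contraTneq w0 => ->; rewrite mulr0 mul0r ltxx.
have P1 : 0 < P by apply: lt_le_trans CP.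
split; first by rewrite !mulr_gt0.
by rewrite mul1r; field; rewrite !lt0r_neq0.
Qed.

Lemma step_prod_le S k s x : size s = k.+1 -> uniq (x :: s) -> 0 <= S ->
  2 ^+ k * step_prod S (x :: s) <=
  S * ((weight_deg x + 2 * pair_total - (weight_deg (last x s) - p (last x s))) / k.+2%:R) ^+ k.+2.
Proof.
move=> sk us S0; rewrite /step_prod mulrCA ler_wpM2l //.
apply: le_trans (prod_le_mean_double _ _ _) _; rewrite ?size_step_weights ?weight_deg_ge0 ?step_weights_ge0 //.
have s0 : \sum_(z <- step_weights s) z <= pair_total.
  by apply: sum_step_weights; case/andP: us.
have xn : weight_deg x + 2 * (\sum_(z <- step_weights s) z) - last 0 (step_weights s) >= 0.
  have := last_le_sum (step_weights_ge0 s); have := weight_deg_ge0 x.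
  have : 0 <= \sum_(z <- step_weights s) z.
    by rewrite big_seq; apply: sumr_ge0 => z /(allP (step_weights_ge0 _)).
  move: (\sum_(_ <- _) _) (last _ _) => a b; lra.
rewrite lerXn2r // ?nnegrE ?divr_ge0 //; last first.
  case: s sk us s0 xn => // y s _ _ s0 xn; rewrite ler_pM2r ?invr_gt0 ?ltr0n //.
  rewrite last_step_weights [last x _]/= (weight_degE (last y s)).
  move: (new_weight _ _) (p _) (weight_deg x) (\sum_(_ <- _) _) s0 => a b c d; lra.
apply: le_trans xn _.
case: s sk us s0 => // y s _ _ s0.
rewrite last_step_weights [last x _]/= (weight_degE (last y s)).
move: (new_weight _ _) (p _) (weight_deg x) (\sum_(_ <- _) _) s0 => a b c d; lra.
Qed.

(** The mean of [1 / a] and [1 / b] is at least the inverse of their geometric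
    mean. *)
Lemma harmonic_bound (w a b Y : R) : 0 <= w -> 0 < a -> 0 < b -> 0 < Y ->
  a * b <= Y ^+ 2 -> w <= Y / 2 * (w / a + w / b).
Proof.
move=> w0 a0 b0 Y0 abY.
have ab0 : 0 < a * b by rewrite mulr_gt0.
have -> : Y / 2 * (w / a + w / b) = w * ((Y * (a + b)) / (2 * (a * b))).
  by field; rewrite !lt0r_neq0.
rewrite ler_peMr // ler_pdivlMr ?mulr_gt0 // mul1r.
have [a1 [b1 Y1]] : 0 <= a /\ 0 <= b /\ 0 <= Y by rewrite !ltW.
rewrite -ler_sqr ?nnegrE ?mulr_ge0 ?addr_ge0 //.
apply: (@le_trans _ _ (a * b * (a + b) ^+ 2)).
  have -> : (2 * (a * b)) ^+ 2 = a * b * (4 * (a * b)) by ring.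
  by rewrite ler_pM2l //; have := sqr_ge0 (a - b); lra.
by rewrite [leRHS]exprMn ler_wpM2r // sqr_ge0.
Qed.

(** The single weights [p] count only at the two ends of a path, and accordingly
    they enter the bound with less than the full coefficient.  This deficit is
    what pays for the walks outside the main term. *)
Theorem path_weight_sum k :
  lsum k.+2 (fun s => (uniq s)%:R * path_weight s) <=
  (2 * pair_total + single_total) * (((4 * pair_total + single_total) / (2 * k.+2%:R)) ^+ k.+2 / 2 ^+ k).
Proof.
have S0 : 0 <= 2 * pair_total + single_total.
  by rewrite -sum_weight_deg; apply: sumr_ge0 => x _; apply: weight_deg_ge0.
have w0 : 0 <= pair_total.
  by rewrite divr_ge0 //; apply: sumr_ge0 => x _; apply: sumr_ge0.
have p0 : 0 <= single_total by apply: sumr_ge0.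
have [S SS] : exists S : R, 2 * pair_total + single_total = S by eexists.
rewrite SS in S0 *.
move: S0; rewrite le0r => /orP[/eqP SE|S0].
  rewrite SE mul0r.
  have d0 x : weight_deg x = 0.
    have : \sum_x weight_deg x = 0 by rewrite sum_weight_deg SS.
    by move/(psumr_eq0P (fun i _ => weight_deg_ge0 i)) => ->.
  rewrite (@eq_lsum _ _ _ _ (fun s => 0 * 0)) ?lsumZl ?mul0r // => -[|x s] _.
    by rewrite /= !mulr0.
  by rewrite /= d0 !(mul0r, mulr0).
have m0 : 0 < 4 * pair_total + single_total by move: S0; rewrite -SS; lra.
set Y := S * _.
have Y0 : 0 < Y by rewrite mulr_gt0 // divr_gt0 ?exprn_gt0 // divr_gt0 // mulr_gt0 ?ltr0n.
(* [Y] is the common bound for the geometric mean of the two quotients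
   [step_prod S s] and [step_prod S (rev s)]. *)
apply: le_trans (_ : lsum k.+2 (fun s => Y / 2 * (walk_law S s + walk_law S (rev s))) <= _); last first.
  rewrite lsumZl lsumD (lsum_rev _ (walk_law S)).
  have := @walk_law_le1 S k.+1 S0; rewrite sum_weight_deg SS => /(_ erefl).
  move: (lsum _ _) => q q1.
  rewrite -[leRHS]mulr1 -mulrA ler_pM2l //; lra.
have q0 s : 0 <= walk_law S s.
  case: s => // x s; rewrite divr_ge0 ?mulr_ge0 ?weight_deg_ge0 ?chain_weight_ge0 ?ler0n ?prod_step_weights_ge0 //.
  exact: ltW.
apply: ler_lsum => s sk.
have [us|_] := boolP (uniq s); last first.
  by rewrite mul0r mulr_ge0 ?addr_ge0 // divr_ge0 // ltW.
rewrite mul1r.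
have := path_weight_ge0 s; rewrite le_eqVlt => /predU1P[<-|ws0].
  by rewrite mulr_ge0 ?addr_ge0 // divr_ge0 // ltW.
have [a0 ->] := walk_lawE us S0 ws0.
have rws0 : 0 < path_weight (rev s) by rewrite path_weight_rev.
have [|b0 ->] := walk_lawE _ S0 rws0; first by rewrite rev_uniq.
rewrite path_weight_rev; apply: harmonic_bound => //; first exact: ltW.
case: s sk us ws0 rws0 a0 b0 => // x s; case/lastP: s => // s y [sk] us _ _.
have rE : rev (x :: rcons s y) = y :: rcons (rev s) x.
  by rewrite rev_cons rev_rcons.
have urs : uniq (y :: rcons (rev s) x) by rewrite -rE rev_uniq.
have skr : size (rcons (rev s) x) = k.+1.
  by move: sk; rewrite !size_rcons size_rev.
rewrite rE; move=> a0 b0.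
have := step_prod_le sk us (ltW S0); have := step_prod_le skr urs (ltW S0).
move: a0 b0; rewrite !last_rcons; set a := step_prod _ _; set b := step_prod _ _.
move=> a0 b0 B A.
have K0 : 0 < 2 ^+ k :> R by rewrite exprn_gt0.
rewrite -(ler_pM2l (mulr_gt0 K0 K0)).
have -> : 2 ^+ k * 2 ^+ k * (a * b) = (2 ^+ k * a) * (2 ^+ k * b) by ring.
have KA : 0 <= 2 ^+ k * a by rewrite ltW // mulr_gt0.
have KB : 0 <= 2 ^+ k * b by rewrite ltW // mulr_gt0.
have xy : x != y.
  by move: us; rewrite /= mem_rcons inE negb_or => /andP[/andP[]].
have pp : p x + p y <= single_total.
  rewrite /single_total (bigD1 x) //= (bigD1 y) /=; last by rewrite eq_sym.
  by rewrite addrA lerDl sumr_ge0.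
apply: le_trans (ler_pM KA KB A B) _.
set u := _ / _; set v := _ / _.
have -> : 2 ^+ k * 2 ^+ k * Y ^+ 2 =
    S * S * (((4 * pair_total + single_total) / (2 * k.+2%:R)) ^+ 2) ^+ k.+2.
  rewrite -exprM mulnC exprM /Y.
  by field; rewrite ?lt0r_neq0.
rewrite mulrACA -exprMn ler_pM2l ?mulr_gt0 //.
have wl z : weight_deg z - p z <= pair_total.
  rewrite weight_degE addrK; have := @sum_step_weights [:: z] isT.
  by rewrite /= big_seq1.
have n0 : 0 < k.+2%:R :> R by rewrite ltr0n.
have u0 : 0 <= u.
  rewrite divr_ge0 ?ler0n //; have := wl y; have := weight_deg_ge0 x; move: w0; lra.
have v0 : 0 <= v.
  rewrite divr_ge0 ?ler0n //; have := wl x; have := weight_deg_ge0 y; move: w0; lra.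
have uvE : u + v = (4 * pair_total + (p x + p y)) / k.+2%:R.
  by rewrite /u /v; field; rewrite lt0r_neq0.
have uvle : (u + v) / 2 <= (4 * pair_total + single_total) / (2 * k.+2%:R).
  rewrite uvE -[leLHS]mulrA -invfM [_ * 2]mulrC ler_pM2r ?invr_gt0 ?mulr_gt0 //.
  by move: pp; lra.
have uv : u * v <= ((4 * pair_total + single_total) / (2 * k.+2%:R)) ^+ 2.
  apply: (@le_trans _ _ (((u + v) / 2) ^+ 2)).
    by have := sqr_ge0 (u - v); rewrite expr_div_n; lra.
  have uv0 : 0 <= (u + v) / 2 by rewrite divr_ge0 ?addr_ge0.
  by apply: lerXn2r => //; rewrite nnegrE // (le_trans uv0).
apply: lerXn2r => //; rewrite nnegrE; first exact: mulr_ge0.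
exact: sqr_ge0.
Qed.
End PathWeights.

(** * Parity of winding for disjoint chains of points *)

Section Parity.
Variable R : realFieldType.
Implicit Types (x y z u v : R * R) (d : R).

(** The lexicographic tie-break makes [above] odd, see [aboveN], also on the
    horizontal axis. *)
Definition above z := (0 < z.2) || ((z.2 == 0) && (0 < z.1)).

(** For a short step [z], [z'] far from the origin: the step crosses the negative
    horizontal half-axis. *)
Definition cross z z' := (above z != above z') && (z.1 < 0).

Definition near_pt d x y := (`|x.1 - y.1| < d) && (`|x.2 - y.2| < d).

Definition far_pt d x y := (2 * d <= `|x.1 - y.1|) || (2 * d <= `|x.2 - y.2|).

(** The parity of the number of times the chain [x :: s] crosses the half-line
    going left from [v]. *)
Fixpoint wind v x s :=
  if s is y :: s' then cross (x - v) (y - v) (+) wind v y s' else false.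

Lemma far_pt_cases d x y : far_pt d x y ->
  [|| 2 * d <= (x - y).1, (x - y).1 <= - (2 * d), 2 * d <= (x - y).2
    | (x - y).2 <= - (2 * d)].
Proof.
by rewrite /far_pt !ler_normr => /orP[]/orP[] H; apply/or4P;
  [constructor 1|constructor 2|constructor 3|constructor 4] => //=; lra.
Qed.

Lemma near_ptE d x y : near_pt d x y ->
  [/\ x.1 - y.1 < d, y.1 - x.1 < d, x.2 - y.2 < d & y.2 - x.2 < d].
Proof. by rewrite /near_pt !ltr_norml => /andP[/andP[? ?] /andP[? ?]]; split; lra. Qed.

Lemma above_pos z : 0 < z.2 -> above z = true.
Proof. by rewrite /above => ->. Qed.

Lemma above_neg z : z.2 < 0 -> above z = false.
Proof. by move=> z0; rewrite /above ltNge ltW //= lt_eqF. Qed.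

Lemma aboveN z : z != 0 -> above (- z) = ~~ above z.
Proof.
case: z => a b; rewrite -pair_eqE /above /= !oppr_gt0 oppr_eq0 negb_or negb_and.
by case: (ltrgtP b 0) => //= _; rewrite ?andbT; case: (ltrgtP a 0).
Qed.

Lemma far_pt_neq d x y : 0 < d -> far_pt d x y -> x - y != 0.
Proof.
move=> d0 /far_pt_cases; apply: contraTneq => -> /=; rewrite !negb_or -!ltNge; lra.
Qed.

Lemma crossN d x y z : 0 < d -> near_pt d x y -> far_pt d x z ->
  cross (x - z) (y - z) (+) cross (z - x) (z - y) =
  above (x - z) (+) above (y - z).
Proof.
move=> d0 /near_ptE[n1 n2 n3 n4] /[dup] fxz /far_pt_cases f.
have xz0 := far_pt_neq d0 fxz.
have yz0 : y - z != 0.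
  by apply: contraTneq f => /eqP; rewrite -pair_eqE /= => /andP[/eqP ? /eqP ?];
     rewrite !negb_or -!ltNge; lra.
rewrite -[z - x]opprB -[z - y]opprB /cross !aboveN //.
move: f n1 n2 n3 n4; case: x y z {fxz xz0 yz0} => [x1 x2] [y1 y2] [z1 z2] /=.
rewrite oppr_lt0 => /or4P[] f n1 n2 n3 n4.
- have -> : x1 - z1 < 0 = false by lra.
  have -> : 0 < x1 - z1 by lra.
  by do 2 case: above.
- have -> : x1 - z1 < 0 by lra.
  have -> : 0 < x1 - z1 = false by lra.
  by do 2 case: above.
- by rewrite !above_pos //=; lra.
- by rewrite !above_neg //=; lra.
Qed.

(** Seen from the origin, the four differences lie in a small square that avoids
    it, so the closed loop around the square does not wind.  Either all four
    have the same strict sign of ordinate, and nothing crosses; or all have the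
    same strict sign of abscissa, and the crossings telescope. *)
Lemma cross_square d x x' y y' : 0 < d -> near_pt d x x' -> near_pt d y y' ->
  far_pt d x y ->
  cross (x - y) (x' - y) (+) cross (x - y') (x' - y') =
  cross (x - y) (x - y') (+) cross (x' - y) (x' - y').
Proof.
move=> d0 /near_ptE[n1 n2 n3 n4] /near_ptE[m1 m2 m3 m4] /far_pt_cases.
move: n1 n2 n3 n4 m1 m2 m3 m4; rewrite /cross.
case: x x' y y' => [x1 x2] [u1 u2] [y1 y2] [v1 v2] /=.
move=> n1 n2 n3 n4 m1 m2 m3 m4 /or4P[] f.
- have -> : x1 - y1 < 0 = false by lra.
  have -> : x1 - v1 < 0 = false by lra.
  have -> : u1 - y1 < 0 = false by lra.
  by rewrite !andbF.
- have -> : x1 - y1 < 0 by lra.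
  have -> : x1 - v1 < 0 by lra.
  have -> : u1 - y1 < 0 by lra.
  by rewrite !andbT; do 4 case: above.
- by rewrite !above_pos //=; lra.
- by rewrite !above_neg //=; lra.
Qed.

(** The crossings of the opposite differences [u - x], which is what two of the
    four sides of a grid of differences of chains produce; [windR_wind] brings
    them back to [wind]. *)
Fixpoint windR u x s :=
  if s is y :: s' then cross (u - x) (u - y) (+) windR u y s' else false.

Lemma windR_wind d u x s : 0 < d -> path (near_pt d) x s ->
  all (fun y => far_pt d y u) (x :: s) ->
  windR u x s = wind u x s (+) above (x - u) (+) above (last x s - u).
Proof.
move=> d0; elim: s x => [|y s IH] x /=; first by rewrite addbb.
move=> /andP[nxy ps] /andP[fx fs].
rewrite IH // [LHS]addbA -addbA; have := crossN d0 nxy fx.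
by case: cross; case: cross; case: wind; case: above; case: above; case: above.
Qed.

Lemma wind_strip d v v' x s : 0 < d -> near_pt d v v' -> path (near_pt d) x s ->
  all (fun y => far_pt d y v) (x :: s) ->
  wind v x s (+) wind v' x s =
  cross (x - v) (x - v') (+) cross (last x s - v) (last x s - v').
Proof.
move=> d0 nv; elim: s x => [|y s IH] x /=; first by rewrite addbb.
move=> /andP[nxy ps] /andP[fx fs].
have := IH y ps fs; have := cross_square d0 nxy nv fx.
by case: cross; case: cross; case: cross; case: cross; case: cross;
  case: wind; case: wind.
Qed.

(** Adding up the small squares of the grid of differences of two chains leaves
    only its boundary. *)
Lemma wind_grid d x s y t : 0 < d ->
  path (near_pt d) x s -> path (near_pt d) y t ->
  allrel (far_pt d) (x :: s) (y :: t) ->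
  wind y x s (+) wind (last y t) x s = windR x y t (+) windR (last x s) y t.
Proof.
move=> d0 ps; elim: t y => [|y' t IH] y /=; first by rewrite !addbb.
move=> /andP[ny pt]; rewrite allrel_consr => /andP[fy ft].
have := IH _ pt ft; have := wind_strip d0 ny ps fy.
by case: wind; case: wind; case: wind; case: windR; case: windR; case: cross;
  case: cross.
Qed.

Lemma far_pt_sym d x y : far_pt d x y = far_pt d y x.
Proof. by rewrite /far_pt distrC [in X in _ || X]distrC. Qed.

(** The right-hand side depends on the four end points alone.  This is the
    vanishing of the van Kampen obstruction for a pair of disjoint curves,
    expressed by winding parities instead of crossing numbers. *)
Lemma wind_disjoint d x s y t : 0 < d ->
  path (near_pt d) x s -> path (near_pt d) y t ->
  allrel (far_pt d) (x :: s) (y :: t) ->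
  let x' := last x s in let y' := last y t in
  wind y x s (+) wind y' x s (+) wind x y t (+) wind x' y t =
  above (x - y) (+) above (x - y') (+) above (x' - y) (+) above (x' - y').
Proof.
move=> d0 ps pt f x' y'.
have far a b : a \in x :: s -> b \in y :: t -> far_pt d b a.
  by move=> ai bi; rewrite far_pt_sym; apply: (allrelP f).
have flip a b : a \in x :: s -> b \in y :: t -> above (b - a) = ~~ above (a - b).
  move=> ai bi; rewrite -opprB aboveN // (far_pt_neq d0) // far_pt_sym.
  exact: far.
have xi : x \in x :: s := mem_head _ _.
have yi : y \in y :: t := mem_head _ _.
have x'i : x' \in x :: s := mem_last _ _.
have y'i : y' \in y :: t := mem_last _ _.
have := wind_grid d0 ps pt f.
rewrite !(@windR_wind d) //; try by apply/allP => b bi; apply: far.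
rewrite -/x' -/y' (flip _ _ xi yi) (flip _ _ xi y'i) (flip _ _ x'i yi) (flip _ _ x'i y'i).
move: (above (x - y)) (above (x - y')) (above (x' - y)) (above (x' - y')).
by move: (wind _ _ _) (wind _ _ _) (wind _ _ _) (wind _ _ _); do 8 case.
Qed.

Lemma addb_eq_even_sum (a b c e a' b' c' e' : bool) :
  a (+) b (+) c (+) e = a' (+) b' (+) c' (+) e' ->
  exists m, (a + b + c + e + (a' + b' + c' + e') = m.*2)%N.
Proof.
by move=> H; exists (a + b + c + e + (a' + b' + c' + e'))./2; move: H;
  case: a; case: b; case: c; case: e; case: a'; case: b'; case: c'; case: e'.
Qed.

(** Add [wind_disjoint] over all 18 pairs of disjoint edges of K33.  An edge and
    a vertex off it occur together in exactly two pairs, so the winding parities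
    cancel.  Among the end point terms, those of two [A] points occur six times
    and those of an [A] point and a [B] point four times with an even number of
    reversals; but those of two [B] points occur three times in each order,
    which adds three.  There are three pairs of [B] points, so the total is
    odd. *)
Lemma no_K33_chains d (A B : 'I_3 -> R * R) (S : 'I_3 -> 'I_3 -> seq (R * R)) :
  0 < d -> (forall i j, path (near_pt d) (A i) (S i j)) ->
  (forall i j, last (A i) (S i j) = B j) ->
  (forall i j k l, i != k -> j != l ->
     allrel (far_pt d) (A i :: S i j) (A k :: S k l)) -> False.
Proof.
move=> d0 pS lS fS.
pose w i j v : nat := wind v (A i) (S i j).
pose x u v : nat := above (u - v).
have eqn i k j l : i != k -> j != l -> exists m,
  (w i j (A k) + w i j (B l) + w k l (A i) + w k l (B j) +
   (x (A i) (A k) + x (A i) (B l) + x (B j) (A k) + x (B j) (B l)) = m.*2)%N.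
  move=> ik jl; have := wind_disjoint d0 (pS i j) (pS k l) (fS _ _ _ _ ik jl).
  by rewrite /= !lS => /addb_eq_even_sum.
have flip u v : far_pt d u v -> (x u v + x v u = 1)%N.
  move=> f; rewrite /x -(opprB v u) aboveN ?(far_pt_neq d0 _) 1?far_pt_sym //.
  by case: above.
have Bi i j : B j \in A i :: S i j by rewrite -(lS i j) mem_last.
have other (i : 'I_3) : exists k, i != k.
  by exists (if i == 0 then 1 else 0); case: (eqVneq i 0) => [->|].
have xBB j l : j != l -> (x (B j) (B l) + x (B l) (B j) = 1)%N.
  move=> jl; apply: flip; have := fS 0 j 1 l isT jl => /allrelP; apply => //.
have xAB i j : (x (A i) (B j) + x (B j) (A i) = 1)%N.
  have [k ik] := other i; have [l jl] := other j; apply: flip.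
  have lj : l != j by rewrite eq_sym.
  by have /allrelP := fS i l k j ik lj; apply; rewrite ?mem_head.
pose i0 : 'I_3 := 0; pose i1 : 'I_3 := 1; pose i2 : 'I_3 := 2%:R.
have [m1 e1] := eqn i0 i1 i0 i1 isT isT.
have [m2 e2] := eqn i0 i1 i1 i0 isT isT.
have [m3 e3] := eqn i0 i1 i0 i2 isT isT.
have [m4 e4] := eqn i0 i1 i2 i0 isT isT.
have [m5 e5] := eqn i0 i1 i1 i2 isT isT.
have [m6 e6] := eqn i0 i1 i2 i1 isT isT.
have [m7 e7] := eqn i0 i2 i0 i1 isT isT.
have [m8 e8] := eqn i0 i2 i1 i0 isT isT.
have [m9 e9] := eqn i0 i2 i0 i2 isT isT.
have [m10 e10] := eqn i0 i2 i2 i0 isT isT.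
have [m11 e11] := eqn i0 i2 i1 i2 isT isT.
have [m12 e12] := eqn i0 i2 i2 i1 isT isT.
have [m13 e13] := eqn i1 i2 i0 i1 isT isT.
have [m14 e14] := eqn i1 i2 i1 i0 isT isT.
have [m15 e15] := eqn i1 i2 i0 i2 isT isT.
have [m16 e16] := eqn i1 i2 i2 i0 isT isT.
have [m17 e17] := eqn i1 i2 i1 i2 isT isT.
have [m18 e18] := eqn i1 i2 i2 i1 isT isT.
have := f_equal2 addn e1 (f_equal2 addn e2 (f_equal2 addn e3
  (f_equal2 addn e4 (f_equal2 addn e5 (f_equal2 addn e6 (f_equal2 addn e7
  (f_equal2 addn e8 (f_equal2 addn e9 (f_equal2 addn e10 (f_equal2 addn e11
  (f_equal2 addn e12 (f_equal2 addn e13 (f_equal2 addn e14 (f_equal2 addn e15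
  (f_equal2 addn e16 (f_equal2 addn e17 e18)))))))))))))))).
clear e1 e2 e3 e4 e5 e6 e7 e8 e9 e10 e11 e12 e13 e14 e15 e16 e17 e18.
have := xBB i0 i1 isT; have := xBB i0 i2 isT; have := xBB i1 i2 isT.
have := xAB i0 i0; have := xAB i0 i1; have := xAB i0 i2.
have := xAB i1 i0; have := xAB i1 i1; have := xAB i1 i2.
have := xAB i2 i0; have := xAB i2 i1; have := xAB i2 i2.
rewrite -!muln2; clear -w x; clearbody w x.
move: (A i0) (A i1) (A i2) (B i0) (B i1) (B i2); clearbody i0 i1 i2 => a0 a1 a2 b0 b1 b2.
lia.
Qed.

End Parity.

(** * Plane drawings have no K33 minor *)

Section Chains.
Variable R : realType.
Local Open Scope classical_set_scope.

Lemma near_pt_ball (d : R) (x y : R * R) : near_pt d x y <-> ball x d y.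
Proof.
by split => [/andP[a b]|[a b]]; [split|apply/andP; split].
Qed.

(** The distance attains a positive minimum on the product of two disjoint
    compact sets. *)
Lemma compact_far (K L : set (R * R)) : compact K -> compact L ->
  K `&` L = set0 -> exists2 d : R, 0 < d & forall x y, K x -> L y -> far_pt d x y.
Proof.
move=> cK cL KL.
have [KL0|KLn0] := pselect (K `*` L !=set0); last first.
  by exists 1 => // x y Kx Ly; case: KLn0; exists (x, y).
pose f (z : (R * R) * (R * R)) : R := `|z.1 - z.2|.
have cf : continuous f.
  move=> z; apply: (@continuous_comp _ _ _ (fun z : (R * R) * (R * R) => z.1 - z.2) (fun u => `|u|)).
    by apply: continuousB; [exact: cvg_fst|exact: cvg_snd].
  exact: norm_continuous.
have [[x0 y0]] := compact_EVT_min KL0 (compact_setX cK cL) (continuous_subspaceT cf).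
rewrite inE => -[/= Kx0 Ly0] fmin.
have f0 : 0 < f (x0, y0).
  rewrite normr_gt0 subr_eq0; apply/eqP => /= xy.
  have KLx : (K `&` L) x0 by split => //; rewrite xy.
  by rewrite KL in KLx.
exists (f (x0, y0) / 2); first by rewrite divr_gt0.
move=> x y Kx Ly; have := fmin (x, y); rewrite inE => /(_ (conj Kx Ly)).
rewrite /far_pt mulrC divfK ?pnatr_eq0 //.
by rewrite {2}/f prod_normE /= le_max.
Qed.

(** The set of the points that a chain can reach is open and closed in [K]. *)
Lemma connected_chain (K : set (R * R)) (d : R) x y : connected K -> 0 < d ->
  K x -> K y ->
  exists s, [/\ path (near_pt d) x s, last x s = y & {in s, forall z, K z}].
Proof.
move=> cK d0 Kx Ky.
pose B := [set z | exists s, [/\ path (near_pt d) x s, last x s = z & {in x :: s, forall z, K z}]].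
have step z z' : B z -> K z' -> near_pt d z z' -> B z'.
  move=> [s [ps ls Ks]] Kz' n; exists (rcons s z').
  rewrite rcons_path ps ls n last_rcons; split => // u.
  by rewrite -rcons_cons mem_rcons inE => /predU1P[->//|/Ks].
have BK z : B z -> K z by case=> s [_ <- Ks]; apply: Ks; exact: mem_last.
have nsym z z' : near_pt d z z' = near_pt d z' z.
  by rewrite /near_pt distrC [in X in _ && X]distrC.
have Bx : B x by exists [::]; split => // z; rewrite inE => /eqP ->.
have BE : B = K.
  apply: cK; first by exists x.
    exists (\bigcup_(z in B) ball z d).
      by apply: bigcup_open => z _; exact: ball_open.
    rewrite eqEsubset; split => z.
      by move=> Bz; split; [exact: BK|exists z => //; exact: ballxx].
    by move=> [Kz [u Bu /near_pt_ball nuz]]; exact: step Bu Kz nuz.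
  exists (~` \bigcup_(z in K `\` B) ball z d).
    by apply: open_closedC; apply: bigcup_open => z _; exact: ball_open.
  rewrite eqEsubset; split => z.
    move=> Bz; split; first exact: BK.
    move=> [u [Ku nBu] /near_pt_ball nuz]; apply: nBu.
    by apply: (step z) => //; rewrite nsym.
  move=> [Kz nz]; apply: contrapT => nBz; apply: nz.
  by exists z => //; exact: ballxx.
have [s [ps ls Ks]] : B y by rewrite BE.
by exists s; split => // z zs; apply: Ks; rewrite inE zs orbT.
Qed.

End Chains.

Section Connected.
Variable V : finType.
Implicit Types (e : rel V) (A B : {set V}).

Definition connected_in e A := forall x y, x \in A -> y \in A ->
  exists s, [/\ path e x s, last x s = y & all (mem A) s].

(** A K33 minor, given by the six branch sets. *)
Record K33_model e (A B : 'I_3 -> {set V}) : Prop := K33Model {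
  K33_connl : forall i, connected_in e (A i);
  K33_connr : forall i, connected_in e (B i);
  K33_disjl : forall i j, i != j -> [disjoint A i & A j];
  K33_disjr : forall i j, i != j -> [disjoint B i & B j];
  K33_disjlr : forall i j, [disjoint A i & B j];
  K33_edge : forall i j, exists x y, [/\ x \in A i, y \in B j & e x y] }.

Definition adj (G : graph V) : rel V := fun x y => [set x; y]%SET \in edges G.

Lemma adj_sym G : symmetric (adj G).
Proof. by move=> x y; rewrite /adj finset.setUC. Qed.

Lemma adj_irr G : irreflexive (adj G).
Proof.
move=> x; apply/negP => H; have /forall_inP/(_ _ H) := edges_card2 G.
by rewrite finset.setUid cards1.
Qed.

End Connected.

Section PlanarK33.
Variables (R : realType) (V : finType) (G : graph V).
Variables (p : V -> R * R) (gamma : {set V} -> R -> R * R).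
Hypothesis drawing : is_plane_drawing G p gamma.
Local Open Scope classical_set_scope.

Let arc (e : {set V}) : set (R * R) := gamma e @` `[0, 1].

Lemma arc_compact e : e \in edges G -> compact (arc e).
Proof.
move=> eG; apply: continuous_compact; first exact: drawing_continuous drawing _ eG.
exact: segment_compact.
Qed.

Lemma arc_connected e : e \in edges G -> connected (arc e).
Proof.
move=> eG; apply: connected_continuous_connected; last exact: drawing_continuous drawing _ eG.
exact: segment_connected.
Qed.

Lemma arc_end e v : e \in edges G -> v \in e -> arc e (p v).
Proof.
move=> eG ve; have := drawing_ends drawing eG.
move/seteqP => [_ /(_ (p v))]; case; first by exists v.
  by move=> ->; exists 0 => //=; rewrite ?in_itv /= lexx ler01.
by move=> ->; exists 1 => //=; rewrite ?in_itv /= lexx ler01.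
Qed.

Lemma arc_pointP e q : e \in edges G -> arc e q ->
  (exists2 v, v \in e & q = p v) \/ (exists2 t, t \in `]0, 1[%R & q = gamma e t).
Proof.
move=> eG [t /=]; rewrite ?in_itv /= => /andP[t0 t1] <-.
have ends s : s = 0 \/ s = 1 -> exists2 v, v \in e & gamma e s = p v.
  move=> Hs; have /seteqP[+ _] := drawing_ends drawing eG.
  move=> /(_ (gamma e s)); case; last by move=> v /= ve <-; exists v.
  by case: Hs => ->; [left|right].
have [->|tn0] := eqVneq t 0; first by left; apply: ends; left.
have [->|tn1] := eqVneq t 1; first by left; apply: ends; right.
right; exists t => //; rewrite in_itv /= !lt_neqAle t0 t1 tn1.
by rewrite eq_sym tn0.
Qed.

Lemma arc_disjoint e e' : e \in edges G -> e' \in edges G ->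
  [disjoint e & e']%B -> arc e `&` arc e' = set0.
Proof.
move=> eG e'G dis; rewrite -subset0 => q [q1 q2].
have [[v ve qv]|[t t01 qt]] := arc_pointP eG q1; last first.
  case: q2 => s s01' qs; have s01 : s \in `[0, 1]%R by exact: s01'.
  have ee' : e != e'.
    apply: contraTneq dis => <-; rewrite -setI_eq0 finset.setIid.
    by have /forall_inP/(_ _ eG) := edges_card2 G; rewrite -cards_eq0 => /eqP ->.
  by have := drawing_no_crossing drawing eG e'G ee' t01 s01; rewrite -qt -qs.
have [[v' v'e qv']|[t t01 qt]] := arc_pointP e'G q2; last first.
  by have := drawing_avoids_vertices drawing (v := v) e'G t01; rewrite -qt.
have vv' : v = v' by apply: (drawing_vertices_inj drawing); rewrite -qv.
by move: dis; rewrite disjoint_subset => /fintype.subsetP/(_ v ve); rewrite inE vv' v'e.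
Qed.

Lemma arcs_far : exists2 d : R, 0 < d & forall e e' x y, e \in edges G ->
  e' \in edges G -> [disjoint e & e']%B -> arc e x -> arc e' y -> far_pt d x y.
Proof.
have H (ee : {set V} * {set V}) : exists d : R, 0 < d /\ (ee.1 \in edges G ->
    ee.2 \in edges G -> [disjoint ee.1 & ee.2]%B ->
    forall x y, arc ee.1 x -> arc ee.2 y -> far_pt d x y).
  case: ee => e e' /=.
  have [/and3P[eG e'G dis]|nH] := boolP [&& e \in edges G, e' \in edges G & [disjoint e & e']%B].
    have [d d0 Hd] := compact_far (arc_compact eG) (arc_compact e'G) (arc_disjoint eG e'G dis).
    by exists d.
  by exists 1; split => // a b c; rewrite a b c in nH.
have [f Hf] := choice H.
exists (\big[Num.min/1]_ee f ee).
  by apply: (big_ind (fun u : R => 0 < u)) => // [x y x0 y0|ee _]; [rewrite lt_min x0|case: (Hf ee)].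
move=> e e' x y eG e'G dis ax ay; have [f0 /(_ eG e'G dis _ _ ax ay)] := Hf (e, e').
have le : \big[Num.min/1]_ee f ee <= f (e, e') by exact: bigmin_le_cond.
by rewrite /far_pt => /orP[] h; apply/orP; [left|right]; apply: le_trans h; rewrite ler_pM2l.
Qed.

(** Concatenating chains along the arcs of a walk replaces the concatenation of
    curves; this is how a minor, and not only a subgraph, is reached. *)
Lemma walk_chain d x s : 0 < d -> path (adj G) x s ->
  exists c, [/\ path (near_pt d) (p x) c, last (p x) c = p (last x s) &
    {in c, forall q, exists e, [/\ e \in edges G, e \subset x :: s & arc e q]}].
Proof.
move=> d0; elim: s x => [|y s IH] x /=; first by exists [::].
move=> /andP[xy ps]; have [c [pc lc Hc]] := IH y ps.
have [c' [pc' lc' Hc']] := connected_chain (arc_connected xy) d0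
  (arc_end xy (set21 _ _)) (arc_end xy (set22 _ _)).
exists (c' ++ c); rewrite cat_path last_cat lc' pc' pc lc; split => // q.
rewrite mem_cat => /orP[/Hc' aq|/Hc[e [eG es aq]]].
  exists [set x; y]%SET; split => //; apply/fintype.subsetP => z.
  by rewrite !inE => /orP[]/eqP ->; rewrite eqxx ?orbT.
exists e; split => //; apply: (fintype.subset_trans es).
by apply/fintype.subsetP => z; rewrite [in X in _ -> X]inE => ->; rewrite orbT.
Qed.

(** Join chosen points of the branch sets by walks inside their unions.  Walks
    for two disjoint edges of K33 stay in disjoint sets of vertices, hence the
    chains along them stay far apart, against [no_K33_chains]. *)
Lemma drawing_no_K33 A B : ~ K33_model (adj G) A B.
Proof.
case=> cA cB dA dB dAB eAB.
have [d d0 far] := arcs_far.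
have exA i : exists x, x \in A i by have [x [y []]] := eAB i ord0; exists x.
have exB i : exists x, x \in B i by have [x [y []]] := eAB ord0 i; exists y.
have [a aA] := choice exA; have [b bB] := choice exB.
have walk (ij : 'I_3 * 'I_3) : exists s, [/\ path (adj G) (a ij.1) s,
    last (a ij.1) s = b ij.2 & {subset a ij.1 :: s <= A ij.1 :|: B ij.2}].
  case: ij => i j /=; have [x [y [xA yB xy]]] := eAB i j.
  have [s [ps ls /allP sA]] := cA i _ _ (aA i) xA.
  have [t [pt lt /allP tB]] := cB j _ _ yB (bB j).
  exists (s ++ y :: t); rewrite cat_path last_cat ls /= ps xy pt lt; split => //.
  move=> z; rewrite inE mem_cat inE finset.inE.
  have zA : z \in s -> z \in A i by move/sA.
  have zB : z \in t -> z \in B j by move/tB.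
  by case/or4P => [/eqP->|/zA ->//|/eqP->|/zB->]; rewrite ?aA ?yB ?orbT.
have [w Hw] := choice walk.
have chain (ij : 'I_3 * 'I_3) : exists c, [/\ path (near_pt d) (p (a ij.1)) c,
    last (p (a ij.1)) c = p (b ij.2) & {in p (a ij.1) :: c, forall q, exists e,
      [/\ e \in edges G, e \subset A ij.1 :|: B ij.2 & arc e q]}].
  have [pw lw sw] := Hw ij; have [c [pc lc Hc]] := walk_chain d0 pw.
  exists c; rewrite lc lw; split => //.
  have sub (e : {set V}) : e \subset a ij.1 :: w ij -> e \subset A ij.1 :|: B ij.2.
    by move=> es; apply: (fintype.subset_trans es); apply/fintype.subsetP.
  move=> q; rewrite inE => /predU1P[->|/Hc[e [eG es aq]]]; last first.
    by exists e; split => //; exact: sub.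
  case: (w ij) pw lw sub => [|y s] /=.
    move=> _ E; have := dAB ij.1 ij.2; rewrite disjoint_subset => /fintype.subsetP/(_ _ (aA _)).
    by rewrite E inE bB.
  move=> /andP[ay _] _ sub; exists [set a ij.1; y]%SET; split => //.
    apply: sub; apply/fintype.subsetP => z.
    by rewrite !inE => /orP[]/eqP ->; rewrite eqxx ?orbT.
  exact: arc_end ay (set21 _ _).
have [c Hc] := choice chain.
apply: (@no_K33_chains _ d (p \o a) (p \o b) (fun i j => c (i, j))) => //.
- by move=> i j; have [] := Hc (i, j).
- by move=> i j; have [] := Hc (i, j).
move=> i j k l ik jl; apply/allrelP => q q' qi q'k.
have [_ _ /(_ q qi)[e [eG es aq]]] := Hc (i, j).
have [_ _ /(_ q' q'k)[e' [e'G e's aq']]] := Hc (k, l).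
apply: (far e e') => //; apply: disjointWl es _; apply: disjointWr e's _.
rewrite -setI_eq0 finset.setIUl !finset.setIUr -!finset.setUA !finset.setU_eq0 !setI_eq0.
by rewrite dA // dAB dB // disjoint_sym dAB.
Qed.

End PlanarK33.

(** * Sparsity of graphs without a K33 minor *)

Section Minors.
Local Open Scope nat_scope.
Variables (V : finType) (e : rel V).
Hypothesis e_sym : symmetric e.
Implicit Types (A B X Y : {set V}) (P S : {set {set V}}).

Definition linked A B := [exists x in A, exists y in B, e x y].

Definition touch A B := (A != B) && linked A B.

Lemma linkedP A B : reflect (exists x y, [/\ x \in A, y \in B & e x y]) (linked A B).
Proof.
apply: (iffP exists_inP) => [[x xA /exists_inP[y yB xy]]|[x [y [xA yB xy]]]].
  by exists x, y.
by exists x => //; apply/exists_inP; exists y.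
Qed.

Lemma linked_sym : symmetric linked.
Proof.
by move=> A B; apply/linkedP/linkedP => -[x [y [xA yB xy]]]; exists y, x; rewrite e_sym.
Qed.

Lemma linkedS A A' B B' : A \subset A' -> B \subset B' -> linked A B -> linked A' B'.
Proof.
move=> /fintype.subsetP sA /fintype.subsetP sB /linkedP[x [y [xA yB xy]]].
by apply/linkedP; exists x, y; rewrite sA ?sB.
Qed.

Lemma linkedUl A B X : linked (A :|: B) X = linked A X || linked B X.
Proof.
apply/idP/orP => [/linkedP[x [y [+ yX xy]]]|[]].
- by rewrite finset.inE => /orP[] xA; [left|right]; apply/linkedP; exists x, y.
- exact: linkedS (finset.subsetUl _ _) (subxx _).
- exact: linkedS (finset.subsetUr _ _) (subxx _).
Qed.

Lemma touch_sym : symmetric touch.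
Proof. by move=> A B; rewrite /touch linked_sym eq_sym. Qed.

Definition fam_deg P A := #|[set B in P | touch A B]|.

Definition common P A B := #|[set X in P | touch A X & touch B X]|.

Definition arcs P := \sum_(A in P) fam_deg P A.

(** [arcs] counts ordered pairs, hence the doubling. *)
Lemma arcsU1 X S : X \notin S -> arcs (X |: S) = (arcs S + (fam_deg S X).*2)%N.
Proof.
move=> XS; have fam_degU Y : fam_deg (X |: S) Y = (touch Y X + fam_deg S Y)%N.
  rewrite /fam_deg; case tYX : (touch Y X).
    rewrite (_ : [set B in X |: S | touch Y B] = X |: [set B in S | touch Y B]).
      by rewrite cardsU1 !finset.inE (negbTE XS).
    apply/finset.setP => B; rewrite !finset.inE.
    by case: eqP => //= ->; rewrite tYX.
  apply: eq_card => B; rewrite !finset.inE.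
  by case: eqP => //= ->; rewrite tYX andbF.
rewrite /arcs big_setU1 //= fam_degU /touch eqxx /= add0n.
rewrite (eq_bigr _ (fun Y _ => fam_degU Y)) big_split /=.
rewrite (_ : \sum_(Y in S) touch Y X = fam_deg S X)%N; first by rewrite addnA addnn addnC.
rewrite /fam_deg -sum1dep_card big_mkcondr /=.
by apply: eq_bigr => Y _; rewrite touch_sym; case: touch.
Qed.

Definition branch_family P :=
  [/\ finset.trivIset P, finset.set0 \notin P & forall A, A \in P -> connected_in e A].

Lemma branch_familyS P S : branch_family P -> S \subset P -> branch_family S.
Proof.
move=> [tP nP cP] SP; split.
- apply/finset.trivIsetP => A B AS BS; move/finset.trivIsetP: tP; apply.
    exact: (fintype.subsetP SP).
  exact: (fintype.subsetP SP).
- by apply: contra nP; exact: (fintype.subsetP SP).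
by move=> A /(fintype.subsetP SP)/cP.
Qed.

Lemma connected_inU A B : connected_in e A -> connected_in e B -> linked A B ->
  connected_in e (A :|: B).
Proof.
move=> cA cB /linkedP[a [b [aA bB ab]]].
have cross X Y x y a' b' : connected_in e X -> connected_in e Y ->
    x \in X -> y \in Y -> a' \in X -> b' \in Y -> e a' b' ->
    exists s, [/\ path e x s, last x s = y & all (mem (X :|: Y)) s].
  move=> cX cY xX yY aX bY aby.
  have [s [ps ls sX]] := cX _ _ xX aX; have [t [pt lt tY]] := cY _ _ bY yY.
  exists (s ++ b' :: t); rewrite cat_path last_cat ps ls /= aby pt lt; split => //.
  rewrite all_cat /= finset.inE bY orbT /=; apply/andP; split.
    by apply: sub_all sX => z; rewrite /= finset.inE => ->.
  by apply: sub_all tY => z; rewrite /= finset.inE => ->; rewrite orbT.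
have within X x y : connected_in e X -> X \subset A :|: B -> x \in X -> y \in X ->
    exists s, [/\ path e x s, last x s = y & all (mem (A :|: B)) s].
  move=> cX sX xX yX; have [s [ps ls aX]] := cX _ _ xX yX; exists s; split => //.
  by apply: sub_all aX => z /=; exact: (fintype.subsetP sX).
move=> x y; rewrite !finset.inE => /orP[xA|xB] /orP[yA|yB].
- exact: within cA (finset.subsetUl _ _) xA yA.
- exact: cross xA yB aA bB ab.
- by rewrite finset.setUC; apply: cross xB yA bB aA _; rewrite // e_sym.
- exact: within cB (finset.subsetUr _ _) xB yB.
Qed.

(** The last two clauses keep track of where the branch sets come from, so that
    branch sets found among the neighbours of a set are adjacent to it. *)
Definition clique_minor P (Q : seq {set V}) :=
  [/\ pairwise (fun A B => [disjoint A & B] && linked A B) Q,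
      forall A, A \in Q -> connected_in e A,
      forall A, A \in Q -> A \subset finset.cover P &
      forall A, A \in Q -> exists2 B, B \in P & B \subset A].

(** Merging [A] and [B] loses the edge between them and one edge for each common
    neighbour. *)
Lemma contract_arcs P A B : branch_family P -> A \in P -> B \in P -> touch A B ->
  exists P', [/\ branch_family P', #|P| = #|P'|.+1,
    arcs P = (arcs P' + (common P A B).*2.+2)%N,
    finset.cover P' = finset.cover P & forall X, X \in P' -> exists2 Y, Y \in P & Y \subset X].
Proof.
move=> [tP nP cP] AP BP /[dup] tAB /andP[AB lAB].
pose S := P :\ A :\ B.
have PE : P = A |: (B |: S).
  rewrite /S finset.setD1K; last by rewrite !finset.inE eq_sym AB.
  by rewrite finset.setD1K.
have dis X Y : X \in P -> Y \in P -> X != Y -> [disjoint X & Y].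
  by move/finset.trivIsetP: tP; apply.
have SP X : X \in S -> [/\ X \in P, X != A & X != B].
  by rewrite !finset.inE => /and3P[].
have ne X : X \in P -> X != finset.set0 by move=> XP; apply: contraNneq nP => <-.
have AS : A \notin B |: S by rewrite !finset.inE eqxx (negbTE AB) andbF.
have BS : B \notin S by rewrite !finset.inE eqxx.
have ABS : A :|: B \notin S.
  apply/negP => /SP[AUP AUA AUB]; have := dis _ _ AUP AP AUA.
  rewrite -setI_eq0 finset.setIUl finset.setIid finset.setU_eq0.
  by rewrite (negbTE (ne _ AP)).
have dU X : X \in S -> [disjoint A :|: B & X].
  move=> /SP[XP XA XB]; rewrite -setI_eq0 finset.setIUl finset.setU_eq0.
  by rewrite !setI_eq0 !dis // eq_sym.
have AUB0 : A :|: B != finset.set0 by rewrite finset.setU_eq0 (negbTE (ne _ AP)).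
exists ((A :|: B) |: S); split.
- split.
  + apply/finset.trivIsetP => X Y; rewrite !in_setU1 => /predU1P[->|XS] /predU1P[->|YS].
    * by rewrite eqxx.
    * by move=> _; exact: dU.
    * by move=> _; rewrite disjoint_sym; exact: dU.
    * by apply: dis; [case: (SP _ XS)|case: (SP _ YS)].
  + rewrite finset.in_setU1 negb_or eq_sym AUB0 /=; apply: contra nP => S0.
    by case: (SP _ S0).
  + move=> X; rewrite finset.in_setU1 => /predU1P[->|/SP[/cP //]].
    by apply: connected_inU => //; exact: cP.
- by rewrite [in LHS]PE !cardsU1 AS BS ABS.
- rewrite [in LHS]PE !arcsU1 //.
  have -> : fam_deg (B |: S) A = (fam_deg S A).+1.
    rewrite /fam_deg (_ : [set X in B |: S | touch A X] = B |: [set X in S | touch A X]).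
      by rewrite cardsU1 !finset.inE eqxx.
    apply/finset.setP => X; rewrite !finset.inE.
    by case: eqP => //= ->; rewrite tAB.
  rewrite {1 2 3}/fam_deg.
  set NA := [set X in S | touch A X]; set NB := [set X in S | touch B X].
  have -> : [set X in S | touch (A :|: B) X] = NA :|: NB.
    apply/finset.setP => X; rewrite !finset.inE -andb_orr.
    have [XS|] := boolP (X \in S); last by rewrite !finset.inE => /negbTE ->.
    have [XP XA XB] := SP _ XS.
    rewrite /touch linkedUl ![_ == X]eq_sym XA XB /=.
    by rewrite (contraNneq _ ABS) // => <-.
  have -> : common P A B = #|NA :&: NB|.
    apply: eq_card => X; rewrite !finset.inE /touch.
    rewrite ![_ == X]eq_sym.
    by case: (X == A); case: (X == B); case: (X \in P); rewrite ?andbF ?andbT.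
  by have := cardsUI NA NB; lia.
- by rewrite [in RHS]PE /finset.cover !finset.bigcup_setU !big_set1 finset.setUA.
move=> X; rewrite finset.in_setU1 => /predU1P[->|/SP[XP _ _]]; last by exists X.
by exists A => //; exact: finset.subsetUl.
Qed.

(** Contract edges whose ends have few common neighbours: this keeps the density.
    When there is none left, every neighbour of a set [A] has many neighbours in
    common with it, so that the neighbourhood of [A] is dense enough for a clique
    minor with one branch set less, to which [A] is added. *)
Theorem dense_clique_minor r P : branch_family P -> P != finset.set0 ->
  (2 ^ r.+1 * #|P| <= arcs P)%N -> exists2 Q, size Q = r & clique_minor P Q.
Proof.
elim: r P => [|r IHr] P; first by exists [::].
have [m] := ubnP #|P|; elim: m P => // m IHm P Pm bP P0 dense.
have [/exists_inP[A AP /exists_inP[B BP /andP[tAB few]]]|noc] :=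
    boolP [exists A in P, exists B in P, touch A B &&
      (common P A B < 2 ^ r.+1)%N].
  have [P' [bP' cP' aP' covP' subP']] := contract_arcs bP AP BP tAB.
  have P'0 : P' != finset.set0.
    apply: contraTneq P0 => P'0; rewrite negbK -cards_eq0 -leqn0.
    have : (0 < #|finset.cover P'|)%N.
      rewrite covP' card_gt0; apply: contraTneq tAB => c0.
      have A0 : A = finset.set0 by apply/eqP; rewrite -finset.subset0 -c0; exact: finset.bigcup_sup.
      by case: bP => _; rewrite -A0 AP.
    by rewrite P'0 /finset.cover big_set0 cards0.
  have [||Q sQ [Q1 Q2 Q3 Q4]] := IHm P' _ bP' P'0.
  - by move: Pm; rewrite cP'.
  - move: dense few; rewrite aP' cP' expnS; set c := common _ _ _.
    by move: (2 ^ r.+1)%N (arcs _) #|_| => k a n; nia.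
  exists Q => //; split => //; first by move=> X /Q3; rewrite covP'.
  move=> X /Q4[Y /subP'[Z ZP ZY] YX]; exists Z => //.
  exact: fintype.subset_trans ZY YX.
have many A B : A \in P -> B \in P -> touch A B ->
    (2 ^ r.+1 <= common P A B)%N.
  move=> AP BP tAB; rewrite leqNgt; apply: contra noc => few.
  by apply/exists_inP; exists A => //; apply/exists_inP; exists B => //; rewrite tAB.
have arcs0 : (0 < arcs P)%N.
  apply: leq_trans dense; by rewrite muln_gt0 expn_gt0 card_gt0 P0.
have [A AP] : exists2 A, A \in P & (0 < fam_deg P A)%N.
  apply/exists_inP; apply: contraLR arcs0; rewrite negb_exists_in -leqNgt leqn0.
  move/forall_inP => H; rewrite sum_nat_eq0; apply/forall_inP => A /H.
  by rewrite -leqNgt leqn0.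
pose N := [set B in P | touch A B].
rewrite /fam_deg -/N card_gt0 => N0.
have NP : N \subset P by apply/fintype.subsetP => B; rewrite inE => /andP[].
have [Q sQ [Q1 Q2 Q3 Q4]] : exists2 Q, size Q = r & clique_minor N Q.
  apply: IHr => //; first exact: branch_familyS NP.
  rewrite mulnC -sum_nat_const; apply: leq_sum => B.
  rewrite inE => /andP[BP tAB]; apply: leq_trans (many A B AP BP tAB) _.
  by apply: subset_leq_card; apply/fintype.subsetP => X; rewrite !inE => /and3P[-> -> ->].
case: (bP) => /finset.trivIsetP tP _ cP.
exists (A :: Q); first by rewrite /= sQ.
split.
- rewrite /= Q1 andbT; apply/allP => X XQ; apply/andP; split.
    apply: disjointWr (Q3 _ XQ) _.
    apply/finset.bigcup_disjointP => B; rewrite inE => /andP[BP /andP[AB _]].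
    exact: tP.
  have [B + BX] := Q4 _ XQ; rewrite inE => /andP[_ /andP[_ lAB]].
  exact: linkedS (subxx _) BX lAB.
- by move=> X; rewrite inE => /predU1P[->|/Q2 //]; exact: cP.
- move=> X; rewrite inE => /predU1P[->|/Q3 XN]; first exact: finset.bigcup_sup.
  apply: fintype.subset_trans XN _; apply/bigcupsP => B /(fintype.subsetP NP) BP.
  exact: finset.bigcup_sup.
move=> X; rewrite inE => /predU1P[->|/Q4[B BN BX]]; first by exists A.
by exists B => //; exact: (fintype.subsetP NP).
Qed.

(** K33 is a subgraph of the complete graph on six vertices. *)
Lemma clique6_K33 P Q : size Q = 6%N -> clique_minor P Q ->
  exists A B : 'I_3 -> {set V}, K33_model e A B.
Proof.
move=> sQ [/(pairwiseP finset.set0) pw cQ _ _].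
have rel i j : i < 6 -> j < 6 -> i != j ->
    [disjoint nth finset.set0 Q i & nth finset.set0 Q j] &&
    linked (nth finset.set0 Q i) (nth finset.set0 Q j).
  move=> i6 j6; case: ltngtP => // ij _; first by apply: pw; rewrite ?inE ?sQ.
  by rewrite disjoint_sym linked_sym; apply: pw; rewrite ?inE ?sQ.
have mem i : i < 6 -> nth finset.set0 Q i \in Q by move=> i6; rewrite mem_nth ?sQ.
exists (fun i => nth finset.set0 Q i), (fun i => nth finset.set0 Q (3 + i)).
have lt i : (i : 'I_3) < 6 by apply: leq_trans (ltn_ord i) _.
have lt3 i : 3 + (i : 'I_3) < 6 by rewrite (ltn_add2l 3 i 3).
have ne3 (i j : 'I_3) : i != 3 + j :> nat.
  by rewrite neq_ltn (leq_trans (ltn_ord i)) ?leq_addr.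
split.
- by move=> i; apply/cQ/mem.
- by move=> i; apply/cQ/mem.
- by move=> i j ij; have /andP[] := rel i j (lt i) (lt j) ij.
- move=> i j ij; have ij3 : 3 + i != 3 + j by rewrite eqn_add2l.
  by have /andP[] := rel _ _ (lt3 i) (lt3 j) ij3.
- by move=> i j; have /andP[] := rel _ _ (lt i) (lt3 j) (ne3 i j).
by move=> i j; have /andP[_ /linkedP] := rel _ _ (lt i) (lt3 j) (ne3 i j).
Qed.

Hypothesis e_irr : irreflexive e.
Hypothesis no_K33 : forall A B : 'I_3 -> {set V}, ~ K33_model e A B.

Lemma connected_in1 x : connected_in e [set x].
Proof.
by move=> y z; rewrite !finset.inE => /eqP -> /eqP ->; exists [::].
Qed.

(** The constant is the density that yields six branch sets, [128 = 2 ^ 7]. *)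
Theorem degree_sum_lt (S : {set V}) : S != finset.set0 ->
  \sum_(x in S) #|[set y in S | e x y]| < 128 * #|S|.
Proof.
move=> S0; rewrite ltnNge; apply/negP => dense.
pose P := [set [set x] | x in S].
have inj1 : {in S &, injective (fun x : V => [set x])} by move=> x y _ _; exact: set1_inj.
have bP : branch_family P.
  split.
  - apply/finset.trivIsetP => _ _ /imsetP[x _ ->] /imsetP[y _ ->] xy.
    by rewrite disjoints1 finset.inE; apply: contraNneq xy => ->.
  - by apply/imsetP => -[x _] /eqP; rewrite eq_sym -cards_eq0 cards1.
  by move=> _ /imsetP[x _ ->]; exact: connected_in1.
have P0 : P != finset.set0.
  by rewrite -card_gt0 card_in_imset ?card_gt0.
have touch1 x y : touch [set x] [set y] = e x y.
  rewrite /touch; apply/andP/idP => [[_ /linkedP[u [v []]]]|xy].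
    by rewrite !finset.inE => /eqP -> /eqP ->.
  split; first by apply: contraTneq xy => /set1_inj ->; rewrite e_irr.
  by apply/linkedP; exists x, y; rewrite !finset.inE.
have [|Q sQ cQ] := @dense_clique_minor 6 P bP P0; last first.
  by have [A [B]] := clique6_K33 sQ cQ; exact: no_K33.
rewrite card_in_imset // /arcs big_imset //=; apply: leq_trans dense _.
apply: leq_sum => x xS; rewrite /fam_deg -(card_in_imset (f := fun y : V => [set y]) (D := [set y in S | e x y])).
  apply: subset_leq_card; apply/fintype.subsetP => _ /imsetP[y + ->].
  by rewrite !finset.inE => /andP[yS xy]; rewrite touch1 xy andbT imset_f.
by move=> y z _ _; exact: set1_inj.
Qed.

(** Remove a vertex of small degree and give it the smallest rank. *)
Theorem degenerate_rank : exists r : V -> nat, injective r /\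
  forall x, #|[set y | e x y & r x < r y]| < 128.
Proof.
suff: forall S : {set V}, exists r : V -> nat, {in S &, injective r} /\
    forall x, x \in S -> #|[set y in S | e x y && (r x < r y)]| < 128.
  move=> /(_ finset.setT)[r [ri rd]]; exists r; split.
    by move=> x y; apply: ri; rewrite finset.inE.
  move=> x; apply: leq_ltn_trans (rd x _); last by rewrite finset.inE.
  by apply: subset_leq_card; apply/fintype.subsetP => y; rewrite !finset.inE.
move=> S; have [m] := ubnP #|S|; elim: m S => // m IHm S Sm.
have [->|S0] := eqVneq S finset.set0.
  by exists (fun=> 0); split => x; rewrite finset.inE.
have [x xS dx] : exists2 x, x \in S & #|[set y in S | e x y]| < 128.
  apply/exists_inP; apply: contraLR (degree_sum_lt S0).
  rewrite negb_exists_in -leqNgt mulnC -sum_nat_const => /forall_inP H.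
  by apply: leq_sum => x xS; rewrite leqNgt H.
have Dx : #|S :\ x| < m by move: Sm; rewrite (cardsD1 x) xS.
have [r [ri rd]] := IHm _ Dx.
exists (fun y => if y == x then 0 else (r y).+1); split.
  move=> y z yS zS; case: eqP => [->|/eqP yx]; case: eqP => [->|/eqP zx] // [].
  by apply: ri; rewrite !finset.inE ?yx ?zx.
move=> y yS; case: eqP => [->|/eqP yx].
  apply: leq_ltn_trans dx; apply: subset_leq_card.
  by apply/fintype.subsetP => z; rewrite !finset.inE => /and3P[-> ->].
apply: leq_ltn_trans (rd y _); last by rewrite !finset.inE yx.
apply: subset_leq_card; apply/fintype.subsetP => z; rewrite !finset.inE.
by case: (z == x) => //=; rewrite ?andbF //= ltnS.
Qed.

Lemma common_nbrs_le2 a b c : a != b -> a != c -> b != c ->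
  #|[set w | [&& e w a, e w b & e w c]]| <= 2.
Proof.
move=> ab ac bc; rewrite leqNgt; apply/negP => /card_gt2P[x [y [z [[xW yW zW] [xy yz zx]]]]].
pose A (i : 'I_3) := [set nth a [:: a; b; c] i].
pose B (i : 'I_3) := [set nth x [:: x; y; z] i].
have uA : uniq [:: a; b; c] by rewrite /= !inE negb_or ab ac bc.
have uB : uniq [:: x; y; z] by rewrite /= !inE negb_or xy yz eq_sym zx.
have eAB (i j : 'I_3) : e (nth x [:: x; y; z] j) (nth a [:: a; b; c] i).
  move: xW yW zW; rewrite !finset.inE => /and3P[x1 x2 x3] /and3P[y1 y2 y3] /and3P[z1 z2 z3].
  move: (nat_of_ord i) (nat_of_ord j) (ltn_ord i) (ltn_ord j).
  by move=> [|[|[|//]]] [|[|[|//]]].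
apply: (no_K33 (A := A) (B := B)); split.
- by move=> i; exact: connected_in1.
- by move=> i; exact: connected_in1.
- by move=> i j ij; rewrite disjoints1 finset.inE nth_uniq.
- by move=> i j ij; rewrite disjoints1 finset.inE nth_uniq.
- move=> i j; rewrite disjoints1 finset.inE; apply: contraTneq (eAB i j) => ->.
  by rewrite e_irr.
move=> i j; exists (nth a [:: a; b; c] i), (nth x [:: x; y; z] j).
by rewrite !finset.inE !eqxx e_sym eAB.
Qed.

End Minors.

(** * Copies of a path and its embeddings *)

Section Copies.
Local Open Scope nat_scope.

(** An injective map with steps of size one can never turn back, so its
    direction is that of its first step. *)
Lemma zigzag_path k (s : nat -> nat) : 2 <= k -> (forall i, i < k -> s i < k) ->
  (forall i j, i < k -> j < k -> s i = s j -> i = j) ->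
  (forall i, i.+1 < k -> s i.+1 = (s i).+1 \/ s i = (s i.+1).+1) ->
  (forall i, i < k -> s i = i) \/ (forall i, i < k -> s i + i = k.-1).
Proof.
move=> k2 sk inj step; case: (step 0 k2) => s1; [left|right].
  have up i : i < k -> s i = s 0 + i.
    elim/ltn_ind: i => -[|[|i]] IH ik; [by rewrite addn0|by rewrite s1 addn1|].
    have E1 := IH _ (ltnSn _) (ltnW ik); have E0 := IH i (ltnW (ltnSn _)) (ltnW (ltnW ik)).
    case: (step i.+1 ik) => E; first by lia.
    have : i = i.+2 by apply: inj; [exact: ltnW (ltnW _)| |lia].
    by lia.
  have kk : k.-1 < k by lia.
  have := sk _ kk; rewrite (up _ kk) => h i ik; rewrite (up _ ik); lia.
have down i : i < k -> s i + i = s 0.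
  elim/ltn_ind: i => -[|[|i]] IH ik; [by rewrite addn0|by rewrite s1 addn1|].
  have E1 := IH _ (ltnSn _) (ltnW ik); have E0 := IH i (ltnW (ltnSn _)) (ltnW (ltnW ik)).
  case: (step i.+1 ik) => E; last by lia.
  have : i = i.+2 by apply: inj; [exact: ltnW (ltnW _)| |lia].
  by lia.
have : s k.-1 + k.-1 = s 0 by apply: down; lia.
have : s 0 < k by apply: sk; lia.
by move=> h0 h1 i ik; have := down i ik; lia.
Qed.

Variables (V : finType) (G : graph V) (k : nat).
Hypothesis k2 : 2 <= k.
Implicit Types f g : {ffun 'I_k -> V}.

Definition embeddings : {set {ffun 'I_k -> V}} :=
  [set f : {ffun 'I_k -> V} | injectiveb f &&
    [forall i : 'I_k, forall j : 'I_k, (j == i.+1 :> nat) ==> adj G (f i) (f j)]].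

Definition copy_of (f : {ffun 'I_k -> V}) : {set V} * {set {set V}} :=
  ((f @: finset.setT)%SET, [set f @: (e : {set 'I_k}) | e in path_edges k]%SET).

Lemma embeddingsP f : reflect (injective f /\
  forall i j : 'I_k, j = i.+1 :> nat -> adj G (f i) (f j)) (f \in embeddings).
Proof.
rewrite inE; apply: (iffP andP) => -[/injectiveP fi H]; split => //.
  by move=> i j /eqP ij; move/forallP/(_ i)/forallP/(_ j)/implyP: H; apply.
apply/forallP => i; apply/forallP => j; apply/implyP => /eqP; exact: H.
Qed.

Lemma path_edgesP (e : {set 'I_k}) :
  reflect (exists i j : 'I_k, j = i.+1 :> nat /\ e = [set i; j]%SET) (e \in path_edges k).
Proof.
rewrite finset.inE; apply: (iffP existsP) => [[i /existsP[j /andP[/eqP ij /eqP ->]]]|[i [j [ij ->]]]].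
  by exists i, j.
by exists i; apply/existsP; exists j; rewrite ij !eqxx.
Qed.

Lemma copies_image : [set S | is_subgraph G S && is_copy (path_graph k) S]%SET = (copy_of @: embeddings)%SET.
Proof.
apply/finset.setP => -[S E]; rewrite finset.inE; apply/andP/imsetP.
  case=> /andP[/fintype.subsetP EG _] /existsP[f /and3P[/injectiveP fi /eqP fS /eqP fE]].
  exists f; last by move: fS fE => /= <- <-.
  apply/embeddingsP; split => // i j ij; rewrite /adj.
  have -> : [set f i; f j]%SET = (f @: [set i; j])%SET by rewrite imsetU1 imset_set1.
  apply: EG; move: fE => /= <-; apply: imset_f; apply/path_edgesP; by exists i, j.
case=> f /embeddingsP[fi fa] [-> ->]; split.
  apply/andP; split => /=.
    apply/fintype.subsetP => _ /imsetP[_ /path_edgesP[i [j [ij ->]]] ->].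
    by rewrite imsetU1 imset_set1; exact: fa.
  apply/forall_inP => _ /imsetP[e _ ->]; exact/imsetS/finset.subsetT.
by apply/existsP; exists f; rewrite !eqxx andbT andbT; apply/injectiveP.
Qed.

Definition reverse (f : {ffun 'I_k -> V}) : {ffun 'I_k -> V} := [ffun i => f (rev_ord i)].

Lemma reverse_embedding f : f \in embeddings -> reverse f \in embeddings.
Proof.
move/embeddingsP => [fi fa]; apply/embeddingsP; split.
  by move=> i j; rewrite !ffunE => /fi; exact: rev_ord_inj.
move=> i j ij; rewrite !ffunE adj_sym; apply: fa => /=.
have := ltn_ord j; lia.
Qed.

Lemma copy_of_reverse f : copy_of (reverse f) = copy_of f.
Proof.
congr pair.
  apply/finset.setP => x; apply/imsetP/imsetP => -[i _ ->].
    by exists (rev_ord i); rewrite ?ffunE ?finset.inE.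
  by exists (rev_ord i); rewrite ?ffunE ?rev_ordK ?finset.inE.
have flip (e : {set 'I_k}) : e \in path_edges k -> (@rev_ord k @: e)%SET \in path_edges k.
  move/path_edgesP => [i [j [ij ->]]]; apply/path_edgesP.
  exists (rev_ord j), (rev_ord i); rewrite imsetU1 imset_set1 finset.setUC; split => //=.
  have := ltn_ord j; lia.
have rE (e : {set 'I_k}) : (reverse f @: e)%SET = (f @: (@rev_ord k @: e))%SET.
  transitivity ((f \o @rev_ord k) @: e)%SET; last exact: imset_comp.
  by apply: eq_imset => i; rewrite /= ffunE.
apply/finset.setP => x; apply/imsetP/imsetP => -[e eP ->].
  by exists (@rev_ord k @: e)%SET; [exact: flip|exact: rE].
exists (@rev_ord k @: e)%SET; first exact: flip.
rewrite rE -!imset_comp.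
by apply: eq_imset => i; rewrite /= rev_ordK.
Qed.

Lemma reverse_neq f : injective f -> reverse f != f.
Proof.
move=> fi; have k0 : 0 < k by lia.
apply/eqP => /ffunP/(_ (Ordinal k0)); rewrite ffunE => /fi/(congr1 val) /=; lia.
Qed.

(** The two embeddings differ by an automorphism of the path, and a path has
    only two automorphisms by [zigzag_path]. *)
Lemma copy_of_fiber f g : f \in embeddings -> g \in embeddings -> copy_of g = copy_of f ->
  g = f \/ g = reverse f.
Proof.
move=> /embeddingsP[fi fa] /embeddingsP[gi ga] [gfV gfE].
have ex i : exists j, g i = f j.
  have : g i \in (g @: finset.setT)%SET by apply: imset_f; rewrite finset.inE.
  by rewrite gfV => /imsetP[j _ ->]; exists j.
have [s Hs] := choice ex.
have si : injective s by move=> i j sij; apply: gi; rewrite !Hs sij.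
have step (i j : 'I_k) : j = i.+1 :> nat -> s j = (s i).+1 :> nat \/ s i = (s j).+1 :> nat.
  move=> ij; have : (g @: [set i; j])%SET \in [set g @: (e : {set 'I_k}) | e in path_edges k]%SET.
    by apply: imset_f; apply/path_edgesP; exists i, j.
  rewrite gfE => /imsetP[_ /path_edgesP[a [b [ab ->]]]].
  rewrite !imsetU1 !imset_set1 !Hs => E.
  have sij : s i != s j by apply: contra_eq_neq ij => /si ->; lia.
  have : f (s i) \in [set f a; f b]%SET by rewrite -E finset.set21.
  have : f (s j) \in [set f a; f b]%SET by rewrite -E finset.set22.
  rewrite !finset.inE !(inj_eq fi) => /orP[]/eqP jE /orP[]/eqP iE.
  - by rewrite iE jE eqxx in sij.
  - by right; rewrite iE jE.
  - by left; rewrite iE jE.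
  - by rewrite iE jE eqxx in sij.
have k0 : 0 < k by lia.
pose t n : nat := s (insubd (Ordinal k0) n).
have tE (i : 'I_k) : t i = s i.
  by rewrite /t; congr (nat_of_ord (s _)); apply: val_inj; rewrite val_insubd ltn_ord.
have tk n (nk : n < k) : t n = s (Ordinal nk) by rewrite -tE.
have := @zigzag_path k t k2; case.
- by move=> i ik; rewrite tk.
- by move=> i j ik jk; rewrite !tk => /val_inj/si [].
- by move=> i ik; rewrite (tk _ ik) (tk _ (ltnW ik)); exact: step.
- move=> H; left; apply/ffunP => i; rewrite Hs; congr (f _); apply: val_inj.
  by rewrite /= -tE H.
move=> H; right; apply/ffunP => i; rewrite Hs ffunE; congr (f _); apply: val_inj.
by rewrite /= -tE; have := H i (ltn_ord i); have := ltn_ord i; lia.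
Qed.

Theorem num_copies_path : (num_copies G (path_graph k)).*2 = #|embeddings|.
Proof.
rewrite /num_copies copies_image -[RHS]sum1_card (partition_big_imset copy_of) /=.
rewrite (eq_bigr (fun=> 2)) ?sum_nat_const ?muln2 // => S /imsetP[f fE ->].
rewrite sum1dep_card (_ : [set _ | _]%SET = [set f; reverse f]%SET).
  by rewrite cards2 eq_sym reverse_neq //; case/embeddingsP: fE.
apply/finset.setP => g; rewrite finset.in_set2 finset.inE.
apply/andP/orP => [[gE /eqP gf]|]; last first.
  by case=> /eqP ->; rewrite ?copy_of_reverse ?reverse_embedding ?fE ?eqxx.
by case: (copy_of_fiber fE gE gf) => ->; [left|right].
Qed.

End Copies.

(** * Counting walks around an ordering of the vertices *)

Section WalkCounts.
Variables (R : realFieldType) (V : finType) (e : rel V).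
Hypothesis e_sym : symmetric e.
Implicit Types (s t : seq V).

Local Notation ind b := ((b : bool)%:R : R).

Lemma ind_ge0 (b : bool) : 0 <= ind b.
Proof. exact: ler0n. Qed.

Lemma ind_le1 (b : bool) : ind b <= 1.
Proof. by case: b; rewrite ?lexx ?ler01. Qed.

Lemma ler_ind (b c : bool) : (b -> c) -> ind b <= ind c.
Proof. by rewrite ler_nat; case: b => // /(_ isT) ->. Qed.

Lemma ind_and (b c : bool) : ind (b && c) = ind b * ind c.
Proof. by rewrite -natrM mulnb. Qed.

Definition num_arcs : R := \sum_x \sum_y ind (e x y).

Definition num_walks k : R := lsum k (fun s => ind (sorted e s)).

Lemma num_arcs_ge0 : 0 <= num_arcs.
Proof. by apply: sumr_ge0 => x _; apply: sumr_ge0. Qed.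

Lemma num_walks_ge0 k : 0 <= num_walks k.
Proof. by apply: lsum_ge0 => s; exact: ind_ge0. Qed.

Lemma sorted_catW s t : sorted e (s ++ t) -> sorted e s && sorted e t.
Proof. by case: s => //= x s; rewrite cat_path => /andP[-> /path_sorted]. Qed.

(** Every other edge of the walk covers all its vertices. *)
Lemma num_walks_even q : num_walks (q * 2) <= num_arcs ^+ q.
Proof.
elim: q => [|q IH]; first by rewrite expr0 /num_walks.
rewrite mulSn exprS /num_walks lsum_cat /=.
rewrite {1}/num_arcs mulr_suml; apply: ler_sum => x _.
rewrite mulr_suml; apply: ler_sum => y _.
apply: le_trans (_ : ind (e x y) * num_walks (q * 2) <= _); last first.
  by apply: ler_wpM2l => //; exact: ind_ge0.
rewrite /num_walks -lsumZl; apply: ler_lsum => s _; rewrite -ind_and; apply: ler_ind.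
by rewrite /= => /andP[-> /path_sorted].
Qed.

Lemma split_at_even l i : (i <= l)%N -> (2 * l + 1 = 2 * i + (1 + (l - i) * 2))%N.
Proof. lia. Qed.

Section Rank.
Variables (r : V -> nat) (K : nat) (B : {set V}).
Hypothesis r_inj : injective r.
Hypothesis r_out : forall x, (#|[set y | e x y & r x < r y]| <= K)%N.

(** At an end of the walk [head] and [last] return the vertex itself, for which
    the comparison is false. *)
Definition descends i t :=
  if drop (2 * i) t is x :: t' then
    (r (head x t') < r x)%N || (r (last x (take (2 * i) t)) < r x)%N
  else false.

Definition avoids i t :=
  if drop (2 * i) t is a :: v :: c :: _ then
    [&& (r a < r v)%N, (r c < r v)%N & v \notin B]
  else false.

Fixpoint odds t := if t is _ :: v :: t' then v :: odds t' else [::].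

Lemma sum_ind (P : pred V) : \sum_x ind (P x) = #|[set x | P x]|%:R.
Proof.
rewrite -sum1dep_card natr_sum [in RHS]big_mkcond /=.
by apply: eq_bigr => x _; case: (P x).
Qed.

(** Delete the vertex in position [2 * i]: the two remaining walks have an even
    number of vertices, and the deleted vertex is one of the at most [K] higher
    neighbours of a vertex next to it. *)
Lemma count_descends l i : (i <= l)%N ->
  lsum (2 * l + 1) (fun t => ind (sorted e t && descends i t)) <=
  2 * K%:R * num_arcs ^+ l.
Proof.
move=> il; rewrite (split_at_even il) lsum_cat.
pose up x y := ind (e x y && (r y < r x)%N).
have upK y : \sum_x up x y <= K%:R.
  rewrite sum_ind ler_nat; apply: leq_trans (r_out y).
  by apply: subset_leq_card; apply/fintype.subsetP => x; rewrite !finset.inE e_sym.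
apply: (@le_trans _ _ (lsum (2 * i) (fun s => lsum ((l - i) * 2) (fun t =>
    2 * K%:R * (ind (sorted e s) * ind (sorted e t)))))); last first.
  rewrite (@eq_lsum _ _ _ _ (fun s => 2 * K%:R * num_walks ((l - i) * 2) * ind (sorted e s))); last first.
    by move=> s _; rewrite lsumZl lsumZl -!mulrA [num_walks _ * _]mulrC.
  rewrite lsumZl -(mulrA (2 * K%:R)) ler_wpM2l ?mulr_ge0 ?ler0n //.
  rewrite -[in leRHS](subnK il) exprD (mulnC 2 i).
  apply: ler_pM; [exact: num_walks_ge0|exact: (num_walks_ge0 (i * 2))| |];
    exact: num_walks_even.
apply: ler_lsum => s ss; rewrite lsumS -lsum_sum; apply: ler_lsum => t _.
apply: (@le_trans _ _ (\sum_x ind (sorted e s) * ind (sorted e t) *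
    (ind (if t is y :: _ then e x y && (r y < r x)%N else false) +
     ind (if s is _ :: _ then e x (last x s) && (r (last x s) < r x)%N else false)))); last first.
  rewrite -mulr_sumr mulrC ler_wpM2r ?mulr_ge0 ?ind_ge0 // big_split /=.
  have -> : 2 * K%:R = K%:R + K%:R :> R by rewrite mulrDl !mul1r.
  apply: lerD.
    by case: t => [|y t]; [rewrite big1|exact: upK].
  by case: s {ss} => [|y s]; [rewrite big1|exact: upK].
apply: ler_sum => x _; rewrite -ind_and.
have [/andP[st]|_] := boolP (_ && _); last by rewrite mulr_ge0 ?addr_ge0 ?ind_ge0.
rewrite /descends -{1 2}ss drop_size_cat // take_size_cat //.
have /andP[-> /path_sorted ->] := sorted_catW st.
rewrite mul1r => /orP[].
  case: t st => [|y t] /=; first by rewrite ltnn.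
  move=> st H; rewrite H andbT; have /andP[_ /=] := sorted_catW st.
  by move=> /andP[-> _]; rewrite lerDl ind_ge0.
case: s {ss} st => [|y s] /=; first by rewrite ltnn.
move=> st H; rewrite H andbT; move: st; rewrite cat_path /= => /and3P[_ + _].
by rewrite e_sym => ->; rewrite lerDr ind_ge0.
Qed.

Definition in_deg v : R := \sum_a ind (e a v && (r a < r v)%N).

(** Delete the vertex in position [2 * i + 1] and its two neighbours: the two
    remaining walks again have an even number of vertices. *)
Lemma count_avoids l i : (i < l)%N ->
  lsum (2 * l + 1) (fun t => ind (sorted e t && avoids i t)) <=
  (\sum_(v | v \notin B) in_deg v ^+ 2) * num_arcs ^+ l.-1.
Proof.
move=> il; have -> : (2 * l + 1 = 2 * i + (3 + (l.-1 - i) * 2))%N by lia.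
rewrite lsum_cat.
apply: (@le_trans _ _ (lsum (2 * i) (fun s => lsum ((l.-1 - i) * 2) (fun t =>
    (\sum_(v | v \notin B) in_deg v ^+ 2) * (ind (sorted e s) * ind (sorted e t)))))); last first.
  rewrite (@eq_lsum _ _ _ _ (fun s => (\sum_(v | v \notin B) in_deg v ^+ 2) * num_walks ((l.-1 - i) * 2) * ind (sorted e s))); last first.
    by move=> s _; rewrite lsumZl lsumZl -!mulrA [num_walks _ * _]mulrC.
  rewrite lsumZl -mulrA ler_wpM2l //; first by apply: sumr_ge0 => v _; exact: sqr_ge0.
  have il1 : (i <= l.-1)%N by lia.
  rewrite -[in leRHS](subnK il1) exprD (mulnC 2 i).
  apply: ler_pM; [exact: num_walks_ge0|exact: (num_walks_ge0 (i * 2))| |];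
    exact: num_walks_even.
apply: ler_lsum => s ss.
change (3 + (l.-1 - i) * 2)%N with ((l.-1 - i) * 2).+3.
rewrite !lsumS; under eq_bigr do (rewrite lsumS; under eq_bigr do rewrite lsumS).
rewrite (eq_bigr (fun a => lsum ((l.-1 - i) * 2) (fun t => \sum_v \sum_c ind (sorted e (s ++ [:: a, v, c & t]) && avoids i (s ++ [:: a, v, c & t]))))); last first.
  by move=> a _; rewrite lsum_sum; apply: eq_bigr => v _; rewrite lsum_sum.
rewrite -lsum_sum; apply: ler_lsum => t _.
rewrite exchange_big /= mulr_suml [leRHS]big_mkcond /=; apply: ler_sum => v _.
have [vB|vB] := boolP (v \notin B); last first.
  rewrite big1 // => a _; rewrite big1 // => c _.
  by rewrite /avoids -ss drop_size_cat // (negbTE vB) !andbF.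
rewrite expr2 {1}/in_deg mulr_suml mulr_suml; apply: ler_sum => a _.
rewrite /in_deg mulr_sumr mulr_suml; apply: ler_sum => c _.
rewrite -!ind_and; apply: ler_ind.
rewrite /avoids -{1}ss drop_size_cat // => /andP[/sorted_catW/andP[-> /=]].
by rewrite [e c v]e_sym => /and3P[-> -> /path_sorted ->] /and3P[-> ->].
Qed.

Lemma odds_notin t : ~~ all (mem B) (odds t) ->
  exists i a v t', drop (2 * i) t = a :: v :: t' /\ v \notin B.
Proof.
have [m] := ubnP (size t); elim: m t => // m IH [|a [|v t]] //= sm.
rewrite negb_and => /orP[vB|]; first by exists 0%N, a, v, t; rewrite muln0 drop0.
move=> /IH[|i [a' [v' [t' [Ht v'B]]]]]; first by move: sm; rewrite !ltnS => /ltnW.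
by exists i.+1, a', v', t'; rewrite mulnS.
Qed.

Lemma subseq_odds t : subseq (odds t) t.
Proof.
have [m] := ubnP (size t); elim: m t => // m IH [//|a [//|v t]] sm.
apply: (@subseq_trans _ (v :: t)); last exact: subseq_cons.
by rewrite /= eqxx; apply: IH; move: sm; rewrite /= !ltnS => /ltnW.
Qed.

(** If no vertex in even position has a lower neighbour, then all vertices in odd
    positions are entered from below on both sides, as neighbours have
    different ranks. *)
Lemma walk_cover l t : irreflexive e -> size t = (2 * l + 1)%N ->
  uniq t && sorted e t ->
  [|| uniq (odds t) && all (mem B) (odds t),
      [exists i : 'I_l.+1, descends i t] | [exists i : 'I_l, avoids i t]].
Proof.
move=> e_irr st /andP[ut et].
rewrite (subseq_uniq (subseq_odds t) ut) /=.
have [//|/odds_notin[i [a [v [t' [Ht vB]]]]]] := boolP (all _ _).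
have [_|nd] := boolP [exists i0 : 'I_l.+1, descends i0 t]; first by rewrite orbT.
rewrite !orFb.
have sd : size (drop (2 * i) t) = (2 * l + 1 - 2 * i)%N by rewrite size_drop st.
move: Ht sd; case: t' => [|c t'] Ht; rewrite Ht /= => sd; first by lia.
have il : (i < l)%N by lia.
apply/existsP; exists (Ordinal il); rewrite /avoids /= Ht vB andbT.
have nd' j : (j <= l)%N -> ~~ descends j t.
  by move=> jl; apply: contra nd => dj; apply/existsP; exists (Ordinal (jl : (j < l.+1)%N)).
have et' : sorted e (drop (2 * i) t) by move: et; rewrite -{1}(cat_take_drop (2 * i) t) => /sorted_catW/andP[].
move: et'; rewrite Ht /= => /and3P[av vc _].
have neq x y : e x y -> r x != r y by move=> xy; apply: contraTneq xy => /r_inj ->; rewrite e_irr.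
have Dt : drop (2 * i.+1) t = c :: t'.
  by rewrite mulnS -addn2 addnC addn2 addnC -drop_drop Ht.
have Tt : last c (take (2 * i.+1) t) = v.
  have -> : take (2 * i.+1) t = take (2 * i) t ++ [:: a; v].
    rewrite -{1}(cat_take_drop (2 * i) t) Ht mulnS.
    have s1 : size (take (2 * i) t) = (2 * i)%N by rewrite size_take; case: ltnP => //; lia.
    by rewrite take_cat s1 ltnNge leq_addl /= addnK.
  by rewrite last_cat.
have := nd' i (ltnW il); have := nd' i.+1 il; rewrite /descends Ht Dt Tt /=.
rewrite !negb_or -!leqNgt => /andP[_ cv] /andP[va _].
by rewrite !ltn_neqAle cv va neq // eq_sym neq.
Qed.

End Rank.

Definition codeg x y : R := \sum_w ind (e w x && e w y).

Definition deg x : R := \sum_w ind (e w x).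

Fixpoint codeg_chain s : R :=
  if s is x :: s' then
    (if s' is y :: _ then codeg x y * codeg_chain s' else 1)
  else 1.

(** For given odd vertices each inner even vertex is a common neighbour of two of
    them, and the last one is a neighbour of the last of them. *)
Lemma count_path_odds m b (g : seq V -> R) :
  lsum (2 * m + 1) (fun t => ind (path e b t) * g (odds t)) =
  lsum m (fun s => g s * (codeg_chain (b :: s) * deg (last b s))).
Proof.
elim: m b g => [|m IH] b g.
  rewrite /= /deg !mul1r mulr_sumr; apply: eq_bigr => x _.
  by rewrite andbT mulrC e_sym.
have -> : (2 * m.+1 + 1 = 2 + (2 * m + 1))%N by lia.
rewrite lsum_cat [LHS]/= [RHS]/= exchange_big /=; apply: eq_bigr => b' _.
rewrite (eq_bigr (fun x => ind (e x b && e x b') * lsum (2 * m + 1) (fun t => ind (path e b' t) * g (b' :: odds t)))); last first.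
  move=> x _; rewrite -lsumZl; apply: eq_lsum => t _ /=.
  by rewrite (e_sym b x) andbA ind_and mulrA.
rewrite -mulr_suml -/(codeg b b') (IH b' (fun s => g (b' :: s))) -lsumZl.
by apply: eq_lsum => s _ /=; ring.
Qed.

Lemma count_sorted_odds m (g : seq V -> R) :
  lsum (2 * m.+1 + 1) (fun t => ind (sorted e t) * g (odds t)) =
  lsum m.+1 (fun s => g s *
    (if s is b :: s' then deg b * codeg_chain s * deg (last b s') else 0)).
Proof.
have -> : (2 * m.+1 + 1 = 2 + (2 * m + 1))%N by lia.
rewrite lsum_cat [LHS]/= [RHS]/= exchange_big /=; apply: eq_bigr => b _.
rewrite (eq_bigr (fun x => ind (e x b) * lsum (2 * m + 1) (fun t => ind (path e b t) * g (b :: odds t)))); last first.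
  move=> x _; rewrite -lsumZl; apply: eq_lsum => t _ /=.
  by rewrite ind_and mulrA.
rewrite -mulr_suml -/(deg b) (count_path_odds m b (fun s => g (b :: s))) -lsumZl.
by apply: eq_lsum => s _ /=; ring.
Qed.

End WalkCounts.

(** * The upper bound *)

Section UpperBound.
Variables (R : realFieldType) (V : finType) (e : rel V).
Hypothesis e_sym : symmetric e.
Hypothesis e_irr : irreflexive e.
Hypothesis no_K33 : forall A B : 'I_3 -> {set V}, ~ K33_model e A B.
Hypothesis V_gt0 : (0 < #|V|)%N.

Local Notation ind b := ((b : bool)%:R : R).
Local Notation n := (#|V|%:R : R).

Lemma card_bigcup_le (I T : finType) (P : pred I) (F : I -> {set T}) :
  (#|\bigcup_(i | P i) F i| <= \sum_(i | P i) #|F i|)%N.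
Proof.
elim/big_rec2: _ => [|i m S _ IH]; first by rewrite cards0.
by apply: leq_trans (leq_card_setU _ _) _; rewrite leq_add2l.
Qed.

Lemma sum_cst (c : R) : \sum_(v : V) c = c * n.
Proof. by rewrite sumr_const mulr_natr. Qed.

Lemma sum_ord_le m (F : 'I_m -> R) c : (forall i, F i <= c) ->
  \sum_i F i <= m%:R * c.
Proof.
move=> Fc; apply: (@le_trans _ _ (\sum_(i < m) c)); first exact: ler_sum.
by rewrite sumr_const card_ord mulr_natl.
Qed.

Lemma num_arcs_le : num_arcs R e <= 128 * n.
Proof.
have V0 : [set: V]%SET != finset.set0 by rewrite -card_gt0 cardsT.
have := ltnW (degree_sum_lt e_sym e_irr no_K33 V0).
rewrite cardsT -(ler_nat R) natr_sum natrM; apply: le_trans.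
rewrite [leRHS](eq_bigl predT); last by move=> x; rewrite finset.in_setT.
apply: ler_sum => x _; rewrite sum_ind ler_nat; apply: subset_leq_card.
by apply/fintype.subsetP => y; rewrite !finset.inE.
Qed.

Lemma degE x : deg R e x = #|[set w | e w x]|%:R.
Proof. exact: sum_ind. Qed.

Lemma sum_deg : \sum_x deg R e x = num_arcs R e.
Proof. by rewrite /num_arcs exchange_big. Qed.

Lemma deg_ge0 x : 0 <= deg R e x.
Proof. by rewrite degE. Qed.

Variables (q : nat) (r : V -> nat).
Hypothesis q_gt0 : (0 < q)%N.
Hypothesis r_inj : injective r.
Hypothesis r_out : forall x, (#|[set y | e x y & r x < r y]| <= 127)%N.

(** The vertices of linear degree; [q] is chosen at the very end, depending on
    the length of the path only. *)
Definition hubs : {set V} := [set v | n < q%:R * deg R e v].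

Local Notation b := (#|hubs|).

Lemma card_hubs : (b <= 128 * q)%N.
Proof.
rewrite -(ler_nat R) -(ler_pM2r (_ : 0 < n)) ?ltr0n //.
apply: (@le_trans _ _ (\sum_(v in hubs) q%:R * deg R e v)).
  rewrite mulr_natl -sumr_const; apply: ler_sum => v.
  by rewrite finset.inE => /ltW.
apply: (@le_trans _ _ (\sum_v q%:R * deg R e v)).
  rewrite [leLHS]big_mkcond /=; apply: ler_sum => v _.
  by case: ifP => // _; rewrite mulr_ge0 ?ler0n ?deg_ge0.
rewrite -mulr_sumr sum_deg natrM mulrAC.
by rewrite [leRHS]mulrC ler_wpM2l ?ler0n ?num_arcs_le.
Qed.

Definition hub_nbrs w := #|[set x in hubs | e w x]|.

Lemma hub_nbrsE w : (hub_nbrs w)%:R = \sum_(x in hubs) ind (e w x).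
Proof.
rewrite /hub_nbrs -sum1dep_card natr_sum big_mkcondr /=.
by apply: eq_bigr => x _; case: (e w x).
Qed.

Lemma hub_nbrs_le w : (hub_nbrs w <= b)%N.
Proof. by apply: subset_leq_card; apply/fintype.subsetP => x; rewrite finset.inE => /andP[]. Qed.

(** Empty for a degenerate triple, so that unions over all triples can be
    formed. *)
Definition triple_nbrs x y z : {set V} :=
  if [&& x != y, x != z & y != z] then [set w | [&& e w x, e w y & e w z]]%SET
  else finset.set0.

Lemma card_triple_nbrs x y z : (#|triple_nbrs x y z| <= 2)%N.
Proof.
rewrite /triple_nbrs; case: ifP; last by rewrite cards0.
by move=> /and3P[? ? ?]; exact: (common_nbrs_le2 e_sym e_irr no_K33).
Qed.

Lemma card_hub_nbrs_ge3 : (#|[set w | 3 <= hub_nbrs w]| <= 2 * b ^ 3)%N.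
Proof.
apply: (@leq_trans #|\bigcup_(x in hubs) \bigcup_(y in hubs) \bigcup_(z in hubs) triple_nbrs x y z|).
  apply: subset_leq_card; apply/fintype.subsetP => w; rewrite finset.inE => /card_gt2P[x [y [z]]].
  rewrite !finset.inE => -[[/andP[xB wx] /andP[yB wy] /andP[zB wz]] [xy yz zx]].
  apply/finset.bigcupP; exists x; first by rewrite finset.inE.
  apply/finset.bigcupP; exists y; first by rewrite finset.inE.
  apply/finset.bigcupP; exists z; first by rewrite finset.inE.
  by rewrite /triple_nbrs xy yz eq_sym zx finset.inE wx wy wz.
apply: leq_trans (card_bigcup_le _ _) _.
rewrite (_ : 2 * b ^ 3 = b * (b * (b * 2)))%N; last by rewrite !expnS expn0; lia.
rewrite -sum_nat_const; apply: leq_sum => x _; apply: leq_trans (card_bigcup_le _ _) _.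
rewrite -sum_nat_const; apply: leq_sum => y _; apply: leq_trans (card_bigcup_le _ _) _.
by rewrite -sum_nat_const; apply: leq_sum => z _; exact: card_triple_nbrs.
Qed.

(** Such an [a] is a common neighbour of [v] and two hubs. *)
Lemma card_two_hub_nbrs v : v \notin hubs ->
  (#|[set a | e a v & 2 <= hub_nbrs a]| <= 2 * b ^ 2)%N.
Proof.
move=> vB.
apply: (@leq_trans #|\bigcup_(x in hubs) \bigcup_(y in hubs) triple_nbrs x y v|).
  apply: subset_leq_card; apply/fintype.subsetP => w; rewrite finset.inE.
  case/andP=> wv /card_gt1P[x [y]]; rewrite !finset.inE => -[/andP[xB wx] /andP[yB wy] xy].
  have xv : x != v by apply: contraNneq vB => <-; rewrite finset.inE.
  have yv : y != v by apply: contraNneq vB => <-; rewrite finset.inE.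
  apply/finset.bigcupP; exists x; first by rewrite finset.inE.
  apply/finset.bigcupP; exists y; first by rewrite finset.inE.
  by rewrite /triple_nbrs xy xv yv finset.inE wx wy wv.
apply: leq_trans (card_bigcup_le _ _) _.
rewrite (_ : 2 * b ^ 2 = b * (b * 2))%N; last by rewrite !expnS expn0; lia.
rewrite -sum_nat_const; apply: leq_sum => x _; apply: leq_trans (card_bigcup_le _ _) _.
by rewrite -sum_nat_const; apply: leq_sum => y _; exact: card_triple_nbrs.
Qed.

(** The vertices that do not contribute to the weight of any pair of hubs. *)
Definition stray : {set V} := [set w | hub_nbrs w <= 1]%N.

Local Notation u := (#|stray|%:R : R).

Definition stray_in_deg v : R := \sum_(a in stray) ind (e a v && (r a < r v)%N).

Lemma in_deg_le v : v \notin hubs ->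
  in_deg R e r v <= stray_in_deg v + (2 * b ^ 2)%:R.
Proof.
move=> vB; rewrite /in_deg (bigID (mem stray)) /= lerD2l.
apply: (@le_trans _ _ #|[set a | e a v & (2 <= hub_nbrs a)%N]|%:R); last first.
  by rewrite ler_nat card_two_hub_nbrs.
rewrite -sum1dep_card natr_sum big_mkcond [leRHS]big_mkcond /=.
apply: ler_sum => a _; rewrite finset.inE -ltnNge.
case: (1 < hub_nbrs a)%N; rewrite ?andbF ?andbT //.
by case: (e a v); rewrite //= ind_le1.
Qed.

Lemma sum_stray_in_deg : \sum_v stray_in_deg v <= 128 * u.
Proof.
rewrite exchange_big /= mulrC mulr_natl -sumr_const; apply: ler_sum => a _.
rewrite sum_ind ler_nat; apply: leq_trans (leq_trans (r_out a) _) => //.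
Qed.

Lemma stray_in_deg_le v : v \notin hubs -> stray_in_deg v <= n / q%:R.
Proof.
rewrite finset.inE -leNgt => dv; rewrite ler_pdivlMr ?ltr0n // mulrC.
apply: le_trans dv; rewrite ler_wpM2l ?ler0n //.
rewrite /stray_in_deg big_mkcond /=; apply: ler_sum => a _.
by case: ifP => _; rewrite ?ind_ge0 //; apply: ler_ind => /andP[].
Qed.

Lemma stray_in_deg_ge0 v : 0 <= stray_in_deg v.
Proof. by apply: sumr_ge0 => a _; exact: ind_ge0. Qed.

(** One factor of the square is at most [n / q] as [v] is not a hub.  The other
    one, summed over all [v], counts edges leaving strays upwards, and there are
    boundedly many of these per stray. *)
Lemma sum_in_deg_sqr : \sum_(v | v \notin hubs) in_deg R e r v ^+ 2 <=
  256 * n * u / q%:R + 8 * (b ^ 4)%:R * n.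
Proof.
apply: (@le_trans _ _ (\sum_v (2 * (n / q%:R) * stray_in_deg v + 8 * (b ^ 4)%:R))).
  rewrite big_mkcond /=; apply: ler_sum => v _; case: ifP => vB; last first.
    rewrite addr_ge0 ?mulr_ge0 ?ler0n ?invr_ge0 ?stray_in_deg_ge0 //.
  have s0 := stray_in_deg_ge0 v; have s1 := stray_in_deg_le vB.
  have c0 : 0 <= (2 * b ^ 2)%:R :> R by [].
  apply: (@le_trans _ _ ((stray_in_deg v + (2 * b ^ 2)%:R) ^+ 2)).
    apply: lerXn2r; rewrite ?nnegrE ?addr_ge0 ?in_deg_le //.
    by apply: sumr_ge0 => a _; exact: ind_ge0.
  have -> : (b ^ 4)%:R = (b ^ 2)%:R ^+ 2 :> R by rewrite -natrX -expnM.
  rewrite natrM; move: (stray_in_deg v) (n / q%:R) ((b ^ 2)%:R : R) s0 s1 => s N c s0 s1.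
  have : s * s <= N * s by rewrite ler_wpM2r.
  have := sqr_ge0 (s - 2 * c); nra.
rewrite big_split /= -mulr_sumr sum_cst.
rewrite lerD2r.
have -> : 256 * n * u / q%:R = 2 * (n / q%:R) * (128 * u) by ring.
by rewrite ler_wpM2l ?sum_stray_in_deg // mulr_ge0 ?divr_ge0.
Qed.

(** Two hubs are weighted by their common neighbours, and a hub by its private
    ones in [pendant_weight]. *)
Definition hub_weight x y : R :=
  if [&& x \in hubs, y \in hubs & x != y] then codeg R e x y else 0.

Definition pendant_weight x : R :=
  if x \in hubs then \sum_(w | hub_nbrs w == 1%N) ind (e w x) else 0.

Lemma codeg_ge0 x y : 0 <= codeg R e x y.
Proof. by apply: sumr_ge0 => w _; exact: ind_ge0. Qed.

Lemma codegC x y : codeg R e x y = codeg R e y x.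
Proof. by apply: eq_bigr => w _; rewrite andbC. Qed.

Lemma hub_weight_ge0 x y : 0 <= hub_weight x y.
Proof. by rewrite /hub_weight; case: ifP; rewrite ?codeg_ge0. Qed.

Lemma hub_weightC x y : hub_weight x y = hub_weight y x.
Proof. by rewrite /hub_weight codegC eq_sym andbCA. Qed.

Lemma pendant_weight_ge0 x : 0 <= pendant_weight x.
Proof. by rewrite /pendant_weight; case: ifP => // _; exact: sumr_ge0. Qed.

Lemma deg_le_weight_deg x : x \in hubs -> deg R e x <= weight_deg hub_weight pendant_weight x.
Proof.
move=> xB; rewrite /weight_deg /pendant_weight xB.
rewrite (eq_bigr (fun y => \sum_w ind ((y \in hubs) && (e w x && e w y)))); last first.
  move=> y yx; rewrite /hub_weight xB eq_sym yx andbT /=.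
  by case: (y \in hubs) => //=; rewrite big1.
rewrite exchange_big [X in _ + X]big_mkcond -big_split; apply: ler_sum => w _ /=.
have [wx|_] := boolP (e w x); last first.
  by rewrite addr_ge0 ?sumr_ge0 //; case: ifP.
have h1 : (0 < hub_nbrs w)%N by apply/card_gt0P; exists x; rewrite finset.inE xB.
have [_|h2] := eqVneq (hub_nbrs w) 1%N; first by rewrite lerDr sumr_ge0.
have /card_gt1P[y [z []]] : (1 < hub_nbrs w)%N by rewrite ltn_neqAle eq_sym h2.
rewrite addr0 !finset.inE => /andP[yB wy] /andP[zB wz] yz.
have main t : t \in hubs -> e w t -> t != x ->
    1 <= \sum_(i | i != x) ind ((i \in hubs) && (true && e w i)).
  by move=> tB wt tx; rewrite (bigD1 t) //= tB wt lerDl sumr_ge0.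
have [yx|yx] := eqVneq y x; last by apply: main yx; rewrite // finset.inE.
by apply: (main z); rewrite // ?finset.inE // -yx eq_sym.
Qed.

Lemma codeg_chain_hubs s : uniq s -> all (mem hubs) s ->
  codeg_chain R e s = chain_weight hub_weight s.
Proof.
elim: s => // x [|y s] IH // /andP[xs us] /andP[xB sB].
have := IH us sB.
change (codeg_chain R e [:: x, y & s]) with (codeg R e x y * codeg_chain R e (y :: s)).
change (chain_weight hub_weight [:: x, y & s]) with (hub_weight y x * chain_weight hub_weight (y :: s)).
move=> ->; rewrite /hub_weight; have /andP[yB _] := sB.
have xy : x != y by move: xs; rewrite inE negb_or => /andP[].
by rewrite (yB : y \in hubs) (xB : x \in hubs) eq_sym xy codegC.
Qed.

(** A vertex with two hub neighbours counts once, and one with more counts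
    boundedly often; of the latter there are boundedly many. *)
Lemma pair_total_le : pair_total hub_weight <= n - u + (b ^ 5)%:R.
Proof.
rewrite /pair_total ler_pdivrMr //.
have -> : \sum_x \sum_(y | y != x) hub_weight x y =
    \sum_w ((hub_nbrs w)%:R ^+ 2 - (hub_nbrs w)%:R).
  rewrite (eq_bigr (fun x => \sum_w \sum_(y | y != x) ind ([&& x \in hubs, y \in hubs & e w x && e w y]))); last first.
    move=> x _; rewrite exchange_big; apply: eq_bigr => y yx.
    rewrite /hub_weight eq_sym yx andbT.
    by case: (x \in hubs); case: (y \in hubs) => //=; rewrite big1.
  rewrite exchange_big; apply: eq_bigr => w _ /=.
  rewrite hub_nbrsE expr2 mulr_suml -sumrB [RHS]big_mkcond /=; apply: eq_bigr => x _.
  have [xB|_] := boolP (x \in hubs); last by rewrite big1.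
  rewrite mulr_sumr [in RHS](bigD1 x) //= -ind_and andbb addrAC subrr add0r.
  rewrite [RHS]big_mkcondl /= big_mkcond [RHS]big_mkcond /=; apply: eq_bigr => y _.
  by case: (y == x) => //=; case: (y \in hubs) => //=; rewrite ?ind_and //; case: ifP.
have -> : (n - u + (b ^ 5)%:R) * 2 =
    \sum_w 2 * (1 - ind (w \in stray)) + (b ^ 2 * (2 * b ^ 3))%:R.
  rewrite -mulr_sumr sumrB sum_cst mul1r sum_ind.
  have -> : [set x in stray]%SET = stray by apply/finset.setP => x; rewrite finset.inE.
  by rewrite mulnCA -expnD natrM; ring.
apply: (@le_trans _ _ (\sum_w (2 * (1 - ind (w \in stray)) + (b ^ 2)%:R * ind (3 <= hub_nbrs w)%N))).
  apply: ler_sum => w _; rewrite finset.inE.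
  have hb : (hub_nbrs w)%:R ^+ 2 <= (b ^ 2)%:R :> R by rewrite -natrX ler_nat leq_exp2r ?hub_nbrs_le.
  case: (hub_nbrs w) hb => [|[|[|h]]] hb /=; rewrite ?subrr ?expr0n ?expr1n ?mulr0 ?addr0 ?subrr ?subr0 //=.
    by rewrite mulr1 expr2 -natrM -natrB.
  by rewrite !mulr1; move: hb; have : 0 <= h.+3%:R :> R by []; lra.
rewrite big_split /= lerD2l -mulr_sumr sum_ind natrM ler_wpM2l // ler_nat.
exact: card_hub_nbrs_ge3.
Qed.

Lemma single_total_le : single_total pendant_weight <= u.
Proof.
rewrite /single_total /pendant_weight -big_mkcond /= exchange_big /=.
rewrite (eq_bigr (fun=> 1)); last by move=> w /eqP h1; rewrite -hub_nbrsE h1.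
rewrite sumr_const ler_nat; apply: subset_leq_card.
by apply/fintype.subsetP => w; rewrite finset.inE unfold_in => /eqP ->.
Qed.

Variable k : nat.
Local Notation l := (k.+2).

Lemma count_hub_walks :
  lsum (2 * l + 1) (fun t => ind (sorted e t) * ind (uniq (odds t) && all (mem hubs) (odds t)))
  <= 4 * (2 * (n + (b ^ 5)%:R) - u) * ((n + (b ^ 5)%:R) / l%:R) ^+ l.
Proof.
rewrite (count_sorted_odds e_sym _ (fun s => ind (uniq s && all (mem hubs) s))).
apply: (@le_trans _ _ (lsum l (fun s => ind (uniq s) * path_weight hub_weight pendant_weight s))).
  apply: ler_lsum => -[|x s] // _.
  have [/andP[us sB]|_] := boolP (_ && _); last first.
    by rewrite mul0r mulr_ge0 ?ind_ge0 // path_weight_ge0 //; [exact: hub_weight_ge0|exact: pendant_weight_ge0].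
  rewrite us !mul1r codeg_chain_hubs // /path_weight.
  have wc0 := chain_weight_ge0 hub_weight_ge0 (x :: s).
  have lB : last x s \in hubs by move/allP: sB; apply; exact: mem_last.
  have xB : x \in hubs by case/andP: sB.
  apply: ler_pM; rewrite ?mulr_ge0 ?deg_ge0 ?deg_le_weight_deg //.
  by rewrite ler_wpM2r ?deg_le_weight_deg.
apply: le_trans (path_weight_sum hub_weight_ge0 hub_weightC pendant_weight_ge0 k) _.
have w0 : 0 <= pair_total hub_weight.
  by rewrite divr_ge0 //; apply: sumr_ge0 => x _; apply: sumr_ge0 => y _; exact: hub_weight_ge0.
have p0 : 0 <= single_total pendant_weight by apply: sumr_ge0 => x _; exact: pendant_weight_ge0.
have := pair_total_le; have := single_total_le.
move: (pair_total _) (single_total _) w0 p0 => w p w0 p0 pu wn.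
have u0 : 0 <= u by [].
set N := n + (b ^ 5)%:R.
have l0 : 0 < k.+2%:R :> R by rewrite ltr0n.
move: (k.+2%:R : R) l0 => L l0.
have wn' : w <= N - u by move: wn; rewrite /N; lra.
have -> : 4 * (2 * N - u) * (N / L) ^+ l = (2 * N - u) * ((4 * N / (2 * L)) ^+ l / 2 ^+ k).
  have -> : 4 * N / (2 * L) = 2 * (N / L) by field; rewrite lt0r_neq0.
  have k0 : 2 ^+ k != 0 :> R by rewrite expf_neq0 ?pnatr_eq0.
  by rewrite [in RHS]exprMn 2![in RHS]exprS; move: (2 ^+ k) (_ ^+ k.+2) k0 => P Q P0; field.
have L1 := ltW l0.
have b0 : 0 <= (4 * w + p) / (2 * L).
  by apply: divr_ge0; rewrite ?mulr_ge0 //; move: w0 p0; lra.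
apply: ler_pM.
- by move: w0 p0; lra.
- by apply: divr_ge0; rewrite ?exprn_ge0.
- by move: wn' pu; lra.
rewrite ler_pM2r ?invr_gt0 ?exprn_gt0 //.
have le : (4 * w + p) / (2 * L) <= (4 * N) / (2 * L).
  by rewrite ler_pM2r ?invr_gt0 ?mulr_gt0 //; move: wn' pu u0; lra.
by apply: lerXn2r; rewrite ?nnegrE // (le_trans b0).
Qed.

Lemma walk_count_split :
  lsum (2 * l + 1) (fun t => ind (uniq t && sorted e t)) <=
  4 * (2 * (n + (b ^ 5)%:R) - u) * ((n + (b ^ 5)%:R) / l%:R) ^+ l +
  l.+1%:R * (256 * (128 * n) ^+ l) +
  l%:R * ((256 * n * u / q%:R + 8 * (b ^ 4)%:R * n) * (128 * n) ^+ k.+1).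
Proof.
have n0 : 0 <= n by [].
have a0 := num_arcs_ge0 R e.
apply: (@le_trans _ _ (lsum (2 * l + 1) (fun t =>
   ind (sorted e t) * ind (uniq (odds t) && all (mem hubs) (odds t)) +
   \sum_(i < l.+1) ind (sorted e t && descends r i t) +
   \sum_(i < l) ind (sorted e t && avoids r hubs i t)))).
  apply: ler_lsum => t st.
  have [/[dup] H /andP[_ et]|_] := boolP (_ && _); last first.
    by rewrite !addr_ge0 ?mulr_ge0 ?ind_ge0 // sumr_ge0 // => i _; exact: ind_ge0.
  have := walk_cover hubs r_inj e_irr st H; rewrite et mul1r.
  set S1 := \sum_(i < l.+1) _; set S2 := \sum_(i < l) _.
  have S10 : 0 <= S1 by apply: sumr_ge0 => i _; exact: ind_ge0.
  have S20 : 0 <= S2 by apply: sumr_ge0 => i _; exact: ind_ge0.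
  case/or3P => [->|/existsP[i di]|/existsP[i di]].
  - by rewrite -addrA lerDl addr_ge0.
  - have : 1 <= S1 by rewrite /S1 (bigD1 i) //= di lerDl sumr_ge0.
    by move=> S11; rewrite -addrA; apply: ler_wpDl; rewrite ?ind_ge0 //; apply: ler_wpDr.
  have : 1 <= S2 by rewrite /S2 (bigD1 i) //= di lerDl sumr_ge0.
  by move=> S21; apply: ler_wpDl => //; rewrite addr_ge0 ?ind_ge0.
rewrite !lsumD !lsum_sum; apply: lerD; first apply: lerD.
- exact: count_hub_walks.
- apply: sum_ord_le => i.
  apply: le_trans (count_descends R e_sym r_out _) _; first by rewrite -ltnS.
  apply: ler_pM; rewrite ?exprn_ge0 ?mulr_ge0 //; first by rewrite -natrM ler_nat.
  by apply: lerXn2r; rewrite ?nnegrE ?mulr_ge0 ?num_arcs_le.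
apply: sum_ord_le => i.
apply: le_trans (count_avoids R e_sym r hubs (ltn_ord i)) _.
apply: ler_pM; rewrite ?exprn_ge0 ?sum_in_deg_sqr //.
  by apply: sumr_ge0 => v _; exact: sqr_ge0.
by apply: lerXn2r; rewrite ?nnegrE ?mulr_ge0 ?num_arcs_le.
Qed.

End UpperBound.

Section UpperAsymptotics.
Variable R : realFieldType.

Lemma exprD_le (x c : R) m : 0 <= x -> 0 <= c ->
  (x + c) ^+ m.+1 <= x ^+ m.+1 + m.+1%:R * c * (x + c) ^+ m.
Proof.
move=> x0 c0; elim: m => [|m IH]; first by rewrite !expr1 expr0 !mulr1 mul1r.
have y0 : 0 <= (x + c) ^+ m.+1 by rewrite exprn_ge0 ?addr_ge0.
have xy : x * (x + c) ^+ m <= (x + c) ^+ m.+1.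
  by rewrite exprS ler_wpM2r ?exprn_ge0 ?addr_ge0 // lerDl.
rewrite exprS mulrDl.
have := ler_wpM2l x0 IH; rewrite mulrDr -exprS => H.
apply: le_trans (lerD H (lexx _)) _; rewrite -addrA lerD2l.
have -> : x * (m.+1%:R * c * (x + c) ^+ m) = m.+1%:R * c * (x * (x + c) ^+ m) by ring.
apply: le_trans (lerD (ler_wpM2l _ xy) (lexx _)) _; first by rewrite mulr_ge0.
by rewrite -[m.+2]addn1 natrD mulrDl mulrDl mul1r.
Qed.

(** The choice of [q] makes the term of order [u * n ^ l] that stems from the
    walks through non-hubs smaller than the one that the hub walks lack.  The
    constant [C] does not depend on the graph. *)
Theorem walk_count_upper k : exists C : R, forall (V : finType) (e : rel V),
  symmetric e -> irreflexive e ->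
  (forall A B : 'I_3 -> {set V}, ~ K33_model e A B) -> (0 < #|V|)%N ->
  lsum (2 * k.+2 + 1) (fun t => (uniq t && sorted e t)%:R) <=
  8 * k.+2%:R * (#|V|%:R / k.+2%:R) ^+ k.+3 + C * #|V|%:R ^+ k.+2.
Proof.
(* Then [2 * l * 128 ^ l / q = 2 / l ^ l], half of the coefficient [4 / l ^ l]
   that [count_hub_walks] leaves in front of [- u * n ^ l]. *)
pose q := (k.+2 ^ k.+3 * 128 ^ k.+2)%N.
have q0 : (0 < q)%N by rewrite muln_gt0 !expn_gt0.
pose c : R := (128 * q)%:R ^+ 5.
exists (8 / k.+2%:R ^+ k.+2 * (k.+3%:R * c * (1 + c) ^+ k.+2) +
  k.+3%:R * (256 * 128 ^+ k.+2) + k.+2%:R * (8 * (128 * q)%:R ^+ 4 * 128 ^+ k.+1)).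
move=> V e e_sym e_irr noK V0.
have [r [r_inj r_out]] := degenerate_rank e_sym e_irr noK.
have r_out' x : (#|[set y | e x y & r x < r y]| <= 127)%N by rewrite -ltnS.
apply: le_trans (walk_count_split R e_sym e_irr noK V0 q0 r_inj r_out' k) _.
have := card_hubs R e_sym e_irr noK V0 q.
have : (#|stray R e q| <= #|V|)%N by exact: max_card.
rewrite -!(ler_nat R) !natrX.
have n1 : 1 <= #|V|%:R :> R by rewrite ler1n.
have u0 : 0 <= #|stray R e q|%:R :> R by [].
have b0 : 0 <= #|hubs R e q|%:R :> R by [].
have qE : q%:R = k.+2%:R ^+ k.+3 * 128 ^+ k.+2 :> R by rewrite natrM !natrX.
have L0 : 0 < k.+2%:R :> R by rewrite ltr0n.
have M0 : 0 <= k.+3%:R :> R by [].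
move: (#|V|%:R : R) (#|stray R e q|%:R : R) (#|hubs R e q|%:R : R) n1 u0 b0 => n u b n1 u0 b0 un bq.
have n0 : 0 <= n by apply: le_trans n1.
have c0 : 0 <= c by rewrite exprn_ge0.
have bc : b ^+ 5 <= c by apply: lerXn2r; rewrite ?nnegrE.
have b4 : b ^+ 4 <= (128 * q)%:R ^+ 4 by apply: lerXn2r; rewrite ?nnegrE.
have L1 := ltW L0.
have main1 : 4 * (2 * (n + b ^+ 5) - u) * ((n + b ^+ 5) / k.+2%:R) ^+ k.+2 <=
    8 / k.+2%:R ^+ k.+2 * (n + c) ^+ k.+3 - 4 * u * (n / k.+2%:R) ^+ k.+2.
  have b5 : 0 <= b ^+ 5 by rewrite exprn_ge0.
  have nb0 : 0 <= n + b ^+ 5 by rewrite addr_ge0.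
  have nc0 : 0 <= n + c by rewrite addr_ge0.
  apply: (@le_trans _ _ (4 * (2 * (n + c) - u) * ((n + c) / k.+2%:R) ^+ k.+2)).
    apply: ler_pM.
    - by rewrite mulr_ge0 //; lra.
    - by rewrite exprn_ge0 // divr_ge0.
    - by rewrite ler_pM2l //; lra.
    apply: lerXn2r; rewrite ?nnegrE; [exact: divr_ge0|exact: divr_ge0|by rewrite ler_pM2r ?invr_gt0 // lerD2l].
  have -> : 4 * (2 * (n + c) - u) * ((n + c) / k.+2%:R) ^+ k.+2 =
     8 / k.+2%:R ^+ k.+2 * (n + c) ^+ k.+3 - 4 * u * ((n + c) / k.+2%:R) ^+ k.+2.
    by rewrite [(n + c) ^+ k.+3]exprS !expr_div_n; ring.
  rewrite lerD2l lerN2 ler_wpM2l ?mulr_ge0 //.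
  by apply: lerXn2r; rewrite ?nnegrE; [exact: divr_ge0|exact: divr_ge0|rewrite ler_pM2r ?invr_gt0 // lerDl].
have main2 : (n + c) ^+ k.+3 <= n ^+ k.+3 + k.+3%:R * c * (1 + c) ^+ k.+2 * n ^+ k.+2.
  apply: le_trans (exprD_le _ n0 c0) _; rewrite lerD2l -[leRHS]mulrA ler_wpM2l ?mulr_ge0 //.
  rewrite -exprMn; apply: lerXn2r; rewrite ?nnegrE ?mulr_ge0 ?addr_ge0 //.
  by rewrite mulrDl mul1r lerD2l ler_peMr.
have main3 : k.+2%:R * ((256 * n * u / q%:R + 8 * b ^+ 4 * n) * (128 * n) ^+ k.+1) <=
   4 * u * (n / k.+2%:R) ^+ k.+2 + k.+2%:R * (8 * (128 * q)%:R ^+ 4 * 128 ^+ k.+1) * n ^+ k.+2.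
  rewrite (mulrDl (256 * n * u / q%:R)).
  rewrite (mulrDr k.+2%:R (256 * n * u / q%:R * _)); apply: lerD.
    have -> : k.+2%:R * (256 * n * u / q%:R * (128 * n) ^+ k.+1) =
        2 * u * (n / k.+2%:R) ^+ k.+2.
      rewrite qE expr_div_n exprMn [n ^+ k.+2]exprS [128 ^+ k.+2]exprS [k.+2%:R ^+ k.+3]exprS.
      have P0 : k.+2%:R ^+ k.+2 != 0 :> R by rewrite expf_neq0 // lt0r_neq0.
      have Q0 : 128 ^+ k.+1 != 0 :> R by rewrite expf_neq0.
      move: L0; move: (k.+2%:R ^+ k.+2) (128 ^+ k.+1) P0 Q0 (k.+2%:R) => P Q P0 Q0 L L0.
      by field; rewrite ?expf_neq0 ?Q0 ?lt0r_neq0.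
    apply: ler_wpM2r; first by rewrite exprn_ge0 // divr_ge0.
    apply: ler_wpM2r => //; lra.
  rewrite exprMn [n ^+ k.+2]exprS.
  have Z0 : 0 <= k.+2%:R * 8 * (128 ^+ k.+1 * (n * n ^+ k.+1)).
    by rewrite !mulr_ge0 ?exprn_ge0.
  move: b4 L1 Z0; move: (b ^+ 4) ((128 * q)%:R ^+ 4) (128 ^+ k.+1) (n ^+ k.+1) (k.+2%:R).
  move=> b4 B4 Q m L b4B L1 Z0.
  have -> : L * (8 * b4 * n * (Q * m)) = L * 8 * (Q * (n * m)) * b4 by ring.
  have -> : L * (8 * B4 * Q) * (n * m) = L * 8 * (Q * (n * m)) * B4 by ring.
  exact: ler_wpM2l.
have eq1 : 8 * k.+2%:R * (n / k.+2%:R) ^+ k.+3 = 8 / k.+2%:R ^+ k.+2 * n ^+ k.+3.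
  rewrite expr_div_n [k.+2%:R ^+ k.+3]exprS.
  have P0 : k.+2%:R ^+ k.+2 != 0 :> R by rewrite expf_neq0 // lt0r_neq0.
  move: L0; move: (k.+2%:R ^+ k.+2) P0 (k.+2%:R) => P P0 L L0.
  by field; rewrite ?expf_neq0 ?lt0r_neq0.
have eq2 : k.+3%:R * (256 * (128 * n) ^+ k.+2) = k.+3%:R * (256 * 128 ^+ k.+2) * n ^+ k.+2.
  by rewrite exprMn; ring.
have P0 : 0 <= 8 / k.+2%:R ^+ k.+2 :> R by rewrite divr_ge0 ?exprn_ge0 // ltW.
have := ler_wpM2l P0 main2; rewrite eq1 eq2 => main4.
move: main1 main3 main4; lra.
Qed.

End UpperAsymptotics.

(** * A plane drawing of the blown-up cycle *)

Section CycleBlowup.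
Variables (R : realType) (n l : nat).
Hypothesis l2 : (2 <= l)%N.
Implicit Types (i j v : 'I_n).

(** The vertices below [l] are the hubs.  A leaf [j] is joined to the hubs
    [j %% l] and [j %% l + 1], the latter modulo [l]. *)
Definition spoke i j : bool :=
  [&& (i < l)%N, (l <= j)%N & ((i == j %% l :> nat) || (i == j.+1 %% l :> nat))%N].

Definition blowup_edges : {set {set 'I_n}} :=
  [set e | [exists i, exists j, spoke i j && (e == [set i; j]%SET)]]%SET.

Lemma blowup_edgesP e :
  reflect (exists i j, spoke i j /\ e = [set i; j]%SET) (e \in blowup_edges).
Proof.
rewrite finset.inE; apply: (iffP existsP) => [[i /existsP[j /andP[ij /eqP ->]]]|[i [j [ij ->]]]].
  by exists i, j.
by exists i; apply/existsP; exists j; rewrite ij eqxx.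
Qed.

Lemma spoke_lt i j : spoke i j -> (i < j)%N.
Proof. by case/and3P => il lj _; exact: leq_trans il lj. Qed.

Fact blowup_card2 : [forall e in blowup_edges, #|e| == 2].
Proof.
apply/forall_inP => e /blowup_edgesP[i [j [ij ->]]]; rewrite cards2.
have := spoke_lt ij; rewrite ltn_neqAle => /andP[+ _].
by case: eqVneq => // ->; rewrite eqxx.
Qed.

Definition blowup : graph 'I_n := Graph blowup_card2.

(** The leaves between two consecutive hubs on the line are drawn above it; those
    between the last hub and the first one are drawn below it. *)
Definition upper v := (v %% l < l.-1)%N.

(** The hubs are the points [0], ..., [l - 1] of the horizontal axis.  The leaves
    of a class are stacked on the vertical line midway between their two hubs,
    at the heights [j %/ l], with the negative sign below the axis. *)
Definition pos_x v : R :=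
  if (v < l)%N then (val v)%:R
  else if upper v then (v %% l)%:R + 1 / 2 else (l.-1)%:R / 2.

Definition pos_y v : R :=
  if (v < l)%N then 0 else if upper v then (v %/ l)%:R else - (v %/ l)%:R.

Definition pos v : R * R := (pos_x v, pos_y v).

(** The horizontal distance between a leaf and its hubs. *)
Definition half_width v : R := if upper v then 1 / 2 else (l.-1)%:R / 2.

(** The straight segment from [a] to [c], with the first coordinate written from
    the side of [c], that is, of the leaf. *)
Definition segment (a c : R * R) (t : R) : R * R :=
  (c.1 + (1 - t) * (a.1 - c.1), a.2 + t * (c.2 - a.2)).

Definition blowup_arc (e : {set 'I_n}) : R -> R * R :=
  if [pick ij : 'I_n * 'I_n | spoke ij.1 ij.2 && (e == [set ij.1; ij.2]%SET)] is Some ij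
  then segment (pos ij.1) (pos ij.2) else fun=> 0.

Lemma blowup_arcE i j : spoke i j ->
  blowup_arc [set i; j]%SET = segment (pos i) (pos j).
Proof.
move=> ij; rewrite /blowup_arc; case: pickP => [[i' j'] /= /andP[ij' /eqP E]|/(_ (i, j))]; last first.
  by rewrite /= ij eqxx.
have lt := spoke_lt ij; have lt' := spoke_lt ij'.
have : i \in [set i'; j']%SET by rewrite -E finset.set21.
have : j \in [set i'; j']%SET by rewrite -E finset.set22.
rewrite !finset.inE => /orP[]/eqP jE /orP[]/eqP iE; subst => //.
- by rewrite ltnn in lt.
- by have := ltn_trans lt lt'; rewrite ltnn.
- by rewrite ltnn in lt.
Qed.

Lemma height_gt0 v : (l <= v)%N -> 0 < (v %/ l)%:R :> R.
Proof. by move=> lv; rewrite ltr0n divn_gt0 //; lia. Qed.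

Lemma pos_y_neq0 v : (l <= v)%N -> pos_y v != 0.
Proof.
move=> lv; rewrite /pos_y ltnNge lv /=.
by case: ifP => _; rewrite ?oppr_eq0 lt0r_neq0 ?height_gt0.
Qed.

Lemma pos_x_spoke i j : spoke i j -> exists2 d : bool,
  pos_x i = pos_x j + (-1) ^+ d * half_width j & pos_y i = 0.
Proof.
case/and3P=> il lj; rewrite /pos_x /pos_y /half_width il ltnNge lj /upper /=.
have c : (j %% l < l)%N by rewrite ltn_mod; lia.
have c1 : (j.+1 %% l = if j %% l < l.-1 then (j %% l).+1 else 0)%N.
  rewrite -addn1 -modnDml; case: ltnP => h.
    by rewrite addn1 (@modn_small (j %% l).+1) //; move: (j %% l)%N h => z h; lia.
  have -> : (j %% l + 1 = l)%N by move: (j %% l)%N h c => z h z2; lia.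
  by rewrite modnn.
rewrite c1 => /orP[]/eqP ->; case: ltnP => h.
- by exists true => //; rewrite expr1; lra.
- exists false => //; rewrite expr0 mul1r.
  have -> : (j %% l = l.-1)%N by lia.
  lra.
- by exists false => //; rewrite expr0 mul1r -natr1; lra.
by exists true => //; rewrite expr1; lra.
Qed.

(** The points of the spokes of a leaf have abscissas strictly within one
    half-width of it, and the strips of different classes on the same side of
    the axis are disjoint. *)
Lemma pos_coincide j j' (s t a a' : R) : (l <= j)%N -> (l <= j')%N ->
  0 < s -> 0 <= t -> -1 < a < 1 -> -1 < a' < 1 ->
  pos_x j + a * half_width j = pos_x j' + a' * half_width j' ->
  s * pos_y j = t * pos_y j' ->
  [/\ upper j = upper j', pos_x j = pos_x j' & a = a'].
Proof.
move=> lj lj' s0 t0 /andP[a1 a2] /andP[a'1 a'2].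
have h := height_gt0 lj; have h' := height_gt0 lj'.
have sh := mulr_gt0 s0 h; have th := mulr_ge0 t0 (ltW h').
rewrite /pos_x /pos_y /half_width ![(_ < l)%N]ltnNge lj lj' /=.
case: ifP => uj; case: ifP => uj' xE yE; try by move: yE; rewrite ?mulrN; lra.
- have cc : (j %% l = j' %% l)%N.
    by apply/eqP; rewrite eqn_leq; apply/andP; split;
      rewrite -ltnS -(ltr_nat R) -natr1; lra.
  by rewrite cc in xE *; split => //; lra.
have m0 : 0 < (l.-1)%:R :> R by rewrite ltr0n; lia.
split => //; apply: (mulIf (lt0r_neq0 m0)); lra.
Qed.

Lemma pos_inj : injective pos.
Proof.
move=> v w /[dup] vw [xE yE].
have [lv|lv] := ltnP v l.
  have [lw|lw] := ltnP w l.
    by move: xE; rewrite /pos_x lv lw => /eqP; rewrite eqr_nat => /eqP /val_inj.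
  by have := pos_y_neq0 lw; rewrite -yE /pos_y lv eqxx.
have [lw|lw] := ltnP w l.
  by have := pos_y_neq0 lv; rewrite yE /pos_y lw eqxx.
have o0 : -1 < (0 : R) < 1 by rewrite ltrN10 ltr01.
have [||uE _ _] := @pos_coincide v w 1 1 0 0 lv lw ltr01 ler01 o0 o0.
- by rewrite !mul0r !addr0.
- by rewrite !mul1r.
move: xE yE; rewrite /pos_x /pos_y ![(_ < l)%N]ltnNge lv lw -uE /=.
have dv := divn_eq v l; have dw := divn_eq w l.
case: ifP => uv.
  move=> /addIr/eqP; rewrite eqr_nat => /eqP mE /eqP; rewrite eqr_nat => /eqP dE.
  by apply: val_inj; rewrite /= dv dw mE dE.
move=> _ /oppr_inj/eqP; rewrite eqr_nat => /eqP dE.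
apply: val_inj; rewrite /= dv dw dE.
have lt x : (x %% l < l)%N by rewrite ltn_mod; lia.
move: uE (lt v) (lt w); rewrite uv => /esym/negbT; move: uv => /negbT.
rewrite /upper -!leqNgt => h1 h2 h3 h4.
by congr (_ + _)%N; lia.
Qed.

Lemma segment0 a c : segment a c 0 = a.
Proof. by case: a c => a1 a2 [c1 c2]; rewrite /segment /=; congr pair; ring. Qed.

Lemma segment1 a c : segment a c 1 = c.
Proof. by case: a c => a1 a2 [c1 c2]; rewrite /segment /=; congr pair; ring. Qed.

Lemma segment_continuous a c : continuous (segment a c).
Proof.
move=> t.
have c1 : {for t, continuous (fun t : R => c.1 + (1 - t) * (a.1 - c.1) : R)}.
  apply: cvgD; first exact: cvg_cst.
  by apply: cvgM; [apply: cvgB; [exact: cvg_cst|exact: cvg_id]|exact: cvg_cst].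
have c2 : {for t, continuous (fun t : R => a.2 + t * (c.2 - a.2) : R)}.
  by apply: cvgD; [exact: cvg_cst|apply: cvgM; [exact: cvg_id|exact: cvg_cst]].
exact: (cvg_pair c1 c2).
Qed.

Lemma segment_spoke i j t : spoke i j -> exists2 d : bool,
  pos_x i = pos_x j + (-1) ^+ d * half_width j &
  segment (pos i) (pos j) t =
    (pos_x j + (-1) ^+ d * (1 - t) * half_width j, t * pos_y j).
Proof.
move=> ij; have [d dE yE] := pos_x_spoke ij; exists d => //.
by rewrite /segment /pos /= yE dE; congr pair; ring.
Qed.

Lemma sign_mul_bounds (d : bool) (t : R) : 0 < t -> t <= 1 ->
  -1 < (-1) ^+ d * (1 - t) < 1.
Proof. by case: d => t0 t1; rewrite ?expr1 ?expr0; apply/andP; split; lra. Qed.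

Lemma spoke_left_inj i i' j j' : spoke i j -> spoke i' j' ->
  pos_x i = pos_x i' -> i = i'.
Proof.
move=> /and3P[il _ _] /and3P[il' _ _]; rewrite /pos_x il il'.
by move=> /eqP; rewrite eqr_nat => /eqP /val_inj.
Qed.

(** A point of an open arc determines the class of its leaf, the side from which
    the leaf is approached and the parameter; the ordinate then determines the
    height of the leaf. *)
Theorem blowup_planar : planar R blowup.
Proof.
exists pos, blowup_arc; split.
- exact: pos_inj.
- move=> _ /blowup_edgesP[i [j [ij ->]]]; rewrite blowup_arcE //.
  apply: continuous_subspaceT; exact: segment_continuous.
- move=> _ /blowup_edgesP[i [j [ij ->]]] s t _ _; rewrite blowup_arcE //.
  case/and3P: (ij) => _ lj _.
  have [d _ ->] := segment_spoke s ij; have [d' _ ->] := segment_spoke t ij.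
  by move=> [_ /(mulIf (pos_y_neq0 lj))].
- move=> _ /blowup_edgesP[i [j [ij ->]]]; rewrite blowup_arcE //.
  rewrite segment0 segment1; apply/seteqP; split => x /=.
    by move=> [->|->]; [exists i|exists j] => //; [exact: finset.set21|exact: finset.set22].
  by move=> [v /=]; rewrite !finset.inE => /orP[]/eqP -> <-; [left|right].
- move=> _ v t /blowup_edgesP[i [j [ij ->]]]; rewrite blowup_arcE //.
  rewrite in_itv /= => /andP[t0 t1].
  case/and3P: (ij) => _ lj _.
  have [d _ ->] := segment_spoke t ij => -[xE yE].
  have lv : (l <= v)%N.
    rewrite leqNgt; apply/negP => lv; move: yE; rewrite [in RHS]/pos_y lv => /eqP.
    by rewrite mulf_eq0 (negbTE (pos_y_neq0 lj)) orbF gt_eqF.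
  have o0 : -1 < (0 : R) < 1 by rewrite ltrN10 ltr01.
  have [||_ _ /eqP] := @pos_coincide j v t 1 _ 0 lj lv t0 ler01 (sign_mul_bounds d t0 (ltW t1)) o0.
  + by rewrite xE mul0r addr0.
  + by rewrite yE mul1r.
  by rewrite mulf_eq0 signr_eq0 subr_eq0 gt_eqF.
move=> _ _ s t /blowup_edgesP[i [j [ij ->]]] /blowup_edgesP[i' [j' [ij' ->]]].
rewrite !blowup_arcE // !in_itv /= => neq /andP[s0 s1] /andP[t0 t1].
case/and3P: (ij) => _ lj _; case/and3P: (ij') => _ lj' _.
have [d dE ->] := segment_spoke s ij; have [d' dE' ->] := segment_spoke t ij'.
move=> [xE yE].
have {}t0 : 0 < t.
  rewrite lt_neqAle t0 andbT; apply: contra_eq_neq yE => <-.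
  by rewrite mul0r mulf_neq0 ?pos_y_neq0 // gt_eqF.
have [uE jE aE] := pos_coincide lj lj' s0 (ltW t0)
  (sign_mul_bounds d s0 (ltW s1)) (sign_mul_bounds d' t0 t1) xE yE.
have [dd st] : d = d' /\ s = t.
  by move: aE s1 t1; case: (d); case: (d'); rewrite ?expr1 ?expr0; split => //; lra.
have jj : j = j'.
  apply: pos_inj; rewrite /pos jE; congr pair.
  by move: yE; rewrite st; apply: mulfI; rewrite gt_eqF.
have ii : i = i' by apply: (spoke_left_inj ij ij'); rewrite dE dE' dd jj.
by rewrite ii jj eqxx in neq.
Qed.

End CycleBlowup.

(** * Paths in the blown-up cycle *)

Section CountBlowup.
Local Open Scope nat_scope.
(** [m] is the number of leaves used from each class. *)
Variables (n l m : nat).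
Hypothesis l2 : 2 <= l.
Hypothesis fits : m.+1 * l <= n.

Fact n_gt0 : 0 < n.
Proof. by apply: leq_trans fits; rewrite muln_gt0; lia. Qed.

Definition vertex (x : nat) : 'I_n := insubd (Ordinal n_gt0) x.

Lemma vertexE x : x < n -> vertex x = x :> nat.
Proof. by move=> xn; rewrite val_insubd xn. Qed.

Definition hub s i := (s + i) %% l.

(** The class of the [i]-th leaf on the path through the hubs [s], [s + 1], ... is
    that between the hubs [s + i - 1] and [s + i].  The first and the last leaf
    may also lie on the other side of their only hub: [c0] adds one to the
    class, and [c1] subtracts one by adding [l - 1]. *)
Definition leaf_class s (c0 c1 : bool) i :=
  (s + l.-1 + i + (if i == 0 then c0 : nat else 0) +
   (if (i == l) && c1 then l.-1 else 0)) %% l.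

Lemma l_gt0 : 0 < l. Proof. lia. Qed.

Lemma hub_lt s i : hub s i < n.
Proof.
apply: (@leq_trans (1 * l)); first by rewrite mul1n ltn_mod l_gt0.
by apply: leq_trans fits; rewrite leq_pmul2r ?l_gt0.
Qed.

Definition leaf s c0 c1 (h : nat -> nat) i := (h i).+1 * l + leaf_class s c0 c1 i.

Lemma leaf_lt s c0 c1 h i : h i < m -> leaf s c0 c1 h i < n.
Proof.
move=> him; apply: leq_trans fits; rewrite /leaf.
apply: (@leq_trans ((h i).+1 * l + l)).
  by rewrite ltn_add2l ltn_mod l_gt0.
by rewrite -mulSnr leq_pmul2r ?l_gt0.
Qed.

Lemma leaf_mod s c0 c1 h i : leaf s c0 c1 h i %% l = leaf_class s c0 c1 i.
Proof. by rewrite modnMDl modn_mod. Qed.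

Lemma leaf_div s c0 c1 h i : leaf s c0 c1 h i %/ l = (h i).+1.
Proof. by rewrite divnMDl ?l_gt0 // divn_small ?addn0 // ltn_mod l_gt0. Qed.

Lemma leaf_ge s c0 c1 h i : l <= leaf s c0 c1 h i.
Proof. by rewrite /leaf mulSn -addnA leq_addr. Qed.

Lemma hub_ltl s i : hub s i < l.
Proof. by rewrite ltn_mod l_gt0. Qed.

Definition blowup_walk s c0 c1 h : {ffun 'I_(2 * l + 1) -> 'I_n} :=
  [ffun a : 'I_(2 * l + 1) =>
     vertex (if odd a then hub s a./2 else leaf s c0 c1 h a./2)].

(** Distinct heights force distinct leaves even within one class.  The paths lost
    by this restriction are too few to matter. *)
Definition proper_heights (h : nat -> nat) :=
  (forall i, i <= l -> h i < m) /\
  (forall i j, i <= l -> j <= l -> h i = h j -> i = j).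

Lemma blowup_walkE s c0 c1 h (a : 'I_(2 * l + 1)) : proper_heights h ->
  blowup_walk s c0 c1 h a = (if odd a then hub s a./2 else leaf s c0 c1 h a./2) :> nat.
Proof.
case=> hm _; rewrite ffunE vertexE //; case: ifP => _; first exact: hub_lt.
by apply/leaf_lt/hm; have := ltn_ord a; lia.
Qed.

Lemma mod_add_inj s i j : i < l -> j < l -> (s + i) %% l = (s + j) %% l -> i = j.
Proof. by move=> il jl /eqP; rewrite eqn_modDl !modn_small // => /eqP. Qed.

Lemma leaf_class_left s c0 c1 i : i < l ->
  hub s i = leaf_class s c0 c1 i \/ hub s i = (leaf_class s c0 c1 i).+1 %% l.
Proof.
move=> il; rewrite /leaf_class /hub (ltn_eqF il) /= addn0.
have E : (s + i = ((s + l.-1 + i) %% l).+1 %[mod l]).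
  rewrite -addn1 modnDml (_ : s + l.-1 + i + 1 = s + i + l); last by lia.
  by rewrite modnDr.
case: ifP => [/eqP i0|_]; last by right; rewrite addn0.
case: c0 => /=; last by right; rewrite addn0.
by left; rewrite E -addn1 modnDml.
Qed.

Lemma leaf_class_right s c0 c1 i : i < l ->
  hub s i = leaf_class s c0 c1 i.+1 \/ hub s i = (leaf_class s c0 c1 i.+1).+1 %% l.
Proof.
move=> il; rewrite /leaf_class /hub /= addn0.
have E : (s + i = s + l.-1 + i.+1 %[mod l]).
  by rewrite (_ : s + l.-1 + i.+1 = s + i + l) ?modnDr //; lia.
case: ifP => _; last by left; rewrite addn0.
right; rewrite -addn1 modnDml (_ : s + l.-1 + i.+1 + l.-1 + 1 = s + i + l + l); last by lia.
by rewrite !modnDr.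
Qed.

Lemma spoke_leaf s c0 c1 h i j (x y : 'I_n) : j <= l ->
  x = hub s i :> nat -> y = leaf s c0 c1 h j :> nat ->
  hub s i = leaf_class s c0 c1 j \/ hub s i = (leaf_class s c0 c1 j).+1 %% l ->
  spoke l x y.
Proof.
move=> jl xE yE H; rewrite /spoke xE yE hub_ltl leaf_ge /= leaf_mod.
rewrite -[(leaf _ _ _ _ _).+1]addn1 -modnDml leaf_mod addn1.
by case: H => ->; rewrite eqxx ?orbT.
Qed.

Lemma spoke_adj (x y : 'I_n) : spoke l x y -> adj (blowup n l) x y.
Proof. by move=> xy; apply/blowup_edgesP; exists x, y. Qed.

Lemma blowup_walk_embedding s c0 c1 h : proper_heights h ->
  blowup_walk s c0 c1 h \in embeddings (blowup n l) (2 * l + 1).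
Proof.
move=> hh; apply/embeddingsP; split.
  move=> a b /(congr1 val) /=; rewrite !blowup_walkE //.
  have al := ltn_ord a; have bl := ltn_ord b.
  have oa := odd_double_half a; have ob := odd_double_half b.
  case: ifP => pa; case: ifP => pb E.
  - rewrite pa in oa; rewrite pb in ob.
    have E2 : a./2 = b./2 by apply: (mod_add_inj _ _ E); lia.
    by apply: val_inj; rewrite /= -oa -ob E2.
  - by have := leaf_ge s c0 c1 h b./2; rewrite -E leqNgt hub_ltl.
  - by have := leaf_ge s c0 c1 h a./2; rewrite E leqNgt hub_ltl.
  rewrite pa in oa; rewrite pb in ob.
  suff E2 : a./2 = b./2 by apply: val_inj; rewrite /= -oa -ob E2.
  have := congr1 (divn^~ l) E; rewrite /= !leaf_div => -[].
  by case: hh => _; apply; lia.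
move=> a b ab; have al := ltn_ord a; have bl := ltn_ord b.
have aE := blowup_walkE s c0 c1 a hh; have bE := blowup_walkE s c0 c1 b hh.
move: aE bE; rewrite ab /= uphalf_half; case: ifP => pa aE bE.
  apply: spoke_adj; apply: (spoke_leaf _ aE bE); first by lia.
  by rewrite add1n; apply: leaf_class_right; have := odd_double_half a; rewrite pa; lia.
rewrite adj_sym; apply: spoke_adj; apply: (spoke_leaf _ bE aE); first by lia.
by rewrite add0n; apply: leaf_class_left; have := odd_double_half a; rewrite pa; lia.
Qed.

Lemma leaf_class_mid s c0 c1 : leaf_class s c0 c1 1 = s %% l.
Proof.
rewrite /leaf_class /= addn0; have -> : (1 == l) = false by lia.
by rewrite /= addn0 (_ : s + l.-1 + 1 = s + l) ?modnDr //; lia.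
Qed.

Lemma leaf_class_inj0 s c0 c1 c0' c1' : leaf_class s c0 c1 0 = leaf_class s c0' c1' 0 -> c0 = c0'.
Proof.
rewrite /leaf_class /= ltn_eqF ?l_gt0 //= !addn0 => /eqP.
by rewrite eqn_modDl; case: c0; case: c0' => //=; rewrite mod0n modn_small.
Qed.

Lemma leaf_class_injl s c0 c1 c0' c1' : leaf_class s c0 c1 l = leaf_class s c0' c1' l -> c1 = c1'.
Proof.
rewrite /leaf_class gtn_eqF ?l_gt0 //= eqxx => /eqP; rewrite eqn_modDl.
by case: c1; case: c1' => //=; rewrite mod0n modn_small; lia.
Qed.

Lemma blowup_walk_inj s c0 c1 h s' c0' c1' h' : s < l -> s' < l ->
  proper_heights h -> proper_heights h' ->
  blowup_walk s c0 c1 h = blowup_walk s' c0' c1' h' ->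
  [/\ s = s', c0 = c0', c1 = c1' & forall i, i <= l -> h i = h' i].
Proof.
move=> sl s'l hh hh' E.
have Ea a (al : a < 2 * l + 1) : (if odd a then hub s a./2 else leaf s c0 c1 h a./2) =
    (if odd a then hub s' a./2 else leaf s' c0' c1' h' a./2).
  by rewrite -(blowup_walkE s c0 c1 (Ordinal al) hh) E blowup_walkE.
have ss : s = s'.
  have l1 : 1 < 2 * l + 1 by lia.
  by have := Ea 1 l1; rewrite /= /hub !addn0 !modn_small.
have Ei i : i <= l -> leaf s c0 c1 h i = leaf s' c0' c1' h' i.
  move=> il; have i2 : i.*2 < 2 * l + 1 by lia.
  by have := Ea _ i2; rewrite odd_double doubleK.
split => //.
- have := congr1 (modn^~ l) (Ei 0 (leq0n _)); rewrite /= !leaf_mod -ss.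
  exact: leaf_class_inj0.
- have := congr1 (modn^~ l) (Ei l (leqnn _)); rewrite /= !leaf_mod -ss.
  exact: leaf_class_injl.
by move=> i il; have := congr1 (divn^~ l) (Ei i il); rewrite /= !leaf_div => -[].
Qed.

(** On a path built here the leaf after the first hub has the class of that hub;
    on a reversed one its class precedes the hub.  For [l = 2] the sequence of
    hubs alone would not tell the direction. *)
Lemma blowup_walk_not_reverse s c0 c1 h s' c0' c1' h' :
  proper_heights h -> proper_heights h' ->
  blowup_walk s c0 c1 h <> reverse (blowup_walk s' c0' c1' h').
Proof.
move=> hh hh' E.
have l1 : 1 < 2 * l + 1 by lia.
have l2' : 2 < 2 * l + 1 by lia.
have := congr1 (fun f : {ffun _ -> 'I_n} => nat_of_ord (f (Ordinal l1))) E.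
have := congr1 (fun f : {ffun _ -> 'I_n} => nat_of_ord (f (Ordinal l2'))) E.
have vE (f : {ffun 'I_(2 * l + 1) -> 'I_n}) (a : 'I_(2 * l + 1)) : reverse f a = f (rev_ord a) :> nat by rewrite ffunE.
have r1 : 2 * l + 1 - (1 : nat).+1 = 2 * l - 1 by lia.
have r2 : 2 * l + 1 - (2 : nat).+1 = 2 * l - 2 by lia.
rewrite !vE !blowup_walkE //= r1 r2.
have -> : odd (2 * l - 2) = false by lia.
have -> : odd (2 * l - 1) = true by lia.
have -> : (2 * l - 2)./2 = l.-1 by lia.
have -> : (2 * l - 1)./2 = l.-1 by lia.
move=> /(congr1 (modn^~ l)) /=; rewrite !leaf_mod leaf_class_mid /hub addn0 => -> E2.
have l1' : l.-1 < l by lia.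
have := E2; rewrite /leaf_class (ltn_eqF l1') /= addn0.
have -> : (l.-1 == 0) = false by lia.
rewrite addn0 -addnA => /eqP; rewrite eqn_modDl.
have -> : l.-1 + l.-1 = l.-2 + l by lia.
by rewrite modnDr !modn_small; lia.
Qed.

(** There are [l] first hubs, two choices at either end, and [m ^_ l.+1] sequences
    of distinct heights.  Distinct choices give distinct subgraphs, as the paths
    built here are all traversed in the same cyclic direction. *)
Theorem num_copies_blowup :
  4 * l * m ^_ l.+1 <= num_copies (blowup n l) (path_graph (2 * l + 1)).
Proof.
pose hts (h : {ffun 'I_l.+1 -> 'I_m}) (i : nat) : nat := if insub i is Some j then h j else 0.
have htsE h (i : 'I_l.+1) : hts h i = h i by rewrite /hts valK.
(* A first hub, the choices at both ends, and the heights. *)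
pose D := [set x : ('I_l * (bool * bool)) * {ffun 'I_l.+1 -> 'I_m} | injectiveb x.2]%SET.
pose F (x : ('I_l * (bool * bool)) * {ffun 'I_l.+1 -> 'I_m}) :=
  blowup_walk x.1.1 x.1.2.1 x.1.2.2 (hts x.2).
have DP x : x \in D -> proper_heights (hts x.2).
  rewrite finset.inE => /injectiveP hi; split => [i il|i j il jl].
    by rewrite -[i]/(val (Ordinal (il : i < l.+1))) htsE ltn_ord.
  rewrite -[i]/(val (Ordinal (il : i < l.+1))) -[j]/(val (Ordinal (jl : j < l.+1))) !htsE.
  by move=> /val_inj/hi ->.
have cD : #|D| = 4 * l * m ^_ l.+1.
  rewrite (_ : D = finset.setX [set: 'I_l * (bool * bool)]%SET [set h : {ffun 'I_l.+1 -> 'I_m} | injectiveb h]%SET); last first.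
    by apply/finset.setP => -[x h]; rewrite !finset.inE.
  by rewrite cardsX cardsT card_inj_ffuns !card_prod !card_ord card_bool; lia.
have k2 : 2 <= 2 * l + 1 by lia.
have emb x : x \in D -> F x \in embeddings (blowup n l) (2 * l + 1).
  by move=> /DP; exact: blowup_walk_embedding.
rewrite -cD /num_copies copies_image.
rewrite -(@card_in_imset _ _ (fun x => copy_of (F x)) D).
  apply: subset_leq_card; apply/fintype.subsetP => _ /imsetP[x xD ->].
  by apply: imset_f; exact: emb.
move=> x y xD yD /= tE.
case: (copy_of_fiber k2 (emb y yD) (emb x xD) tE) => [E|E]; last first.
  by have := blowup_walk_not_reverse (DP x xD) (DP y yD) E.
have [sE c0E c1E hE] := blowup_walk_inj (ltn_ord _) (ltn_ord _) (DP x xD) (DP y yD) E.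
case: x y sE c0E c1E hE {xD yD tE E} => [[s [c0 c1]] h] [[s' [c0' c1']] h'] /=.
move=> /val_inj -> -> -> hE; congr pair; apply/ffunP => i; apply: val_inj => /=.
by rewrite -!htsE; apply: hE; rewrite -ltnS.
Qed.

End CountBlowup.

(** * The asymptotic formula *)

Section Conclusion.
Variable R : realType.

Lemma embeddings_lsum (V : finType) (G : graph V) k :
  #|embeddings G k|%:R =
  lsum k (fun t => (uniq t && sorted (adj G) t)%:R : R).
Proof.
rewrite lsum_tuple -sum1_card natr_sum [RHS](bigID (fun t : k.-tuple V => uniq t && sorted (adj G) t)) /=.
rewrite [X in _ = _ + X]big1 ?addr0; last by move=> t /negbTE ->.
rewrite (reindex_onto (fun t : k.-tuple V => [ffun i => tnth t i]) (fun f : {ffun 'I_k -> V} => [tuple f i | i < k])) /=; last first.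
  by move=> f _; apply/ffunP => i; rewrite ffunE tnth_mktuple.
have tE (t : k.-tuple V) : [tuple [ffun i => tnth t i] i | i < k] = t.
  by apply: eq_from_tnth => i; rewrite tnth_mktuple ffunE.
have key (t : k.-tuple V) :
    ([ffun i => tnth t i] \in embeddings G k) = (uniq t && sorted (adj G) t).
  apply/embeddingsP/andP => -[H1 H2]; split.
  - by apply/tuple_uniqP => i j ij; apply: H1; rewrite !ffunE.
  - case Et: (tval t) => [|x0 s] //; rewrite -Et; apply/(sortedP x0) => i.
    rewrite size_tuple => ik; have := H2 (Ordinal (ltnW ik)) (Ordinal ik) erefl.
    by rewrite !ffunE !(tnth_nth x0).
  - by move=> i j; rewrite !ffunE; exact: (elimT (tuple_uniqP t) H1).
  move=> i j ij; have x0 := tnth t i; rewrite !ffunE !(tnth_nth x0) ij.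
  by apply: (elimT (sortedP x0) H2); rewrite size_tuple -ij.
apply: eq_big => [t|t]; first by rewrite tE eqxx andbT key.
by rewrite key => /andP[->].
Qed.

Lemma ffact_ge m l : ((m - l) ^ l.+1 <= m ^_ l.+1)%N.
Proof.
rewrite -[in leqLHS](card_ord l.+1) ffact_prod -prod_nat_const; apply: leq_prod => i _.
by have := ltn_ord i; lia.
Qed.

Lemma max_copies_upper l : (2 <= l)%N -> exists C : R, forall n, (0 < n)%N ->
  (max_planar_copies R n (path_graph (2 * l + 1)))%:R <=
  4 * l%:R * (n%:R / l%:R) ^+ l.+1 + C * n%:R ^+ l.
Proof.
case: l => [|[|k]] // _; have [C HC] := walk_count_upper R k.
exists `|C| => n n0.
have main (G : graph 'I_n) : planar R G ->
    (num_copies G (path_graph (2 * k.+2 + 1)))%:R <=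
    4 * k.+2%:R * (n%:R / k.+2%:R) ^+ k.+3 + `|C| * n%:R ^+ k.+2 :> R.
  move=> [p [gamma plG]].
  have noK := drawing_no_K33 plG.
  have V0 : (0 < #|'I_n|)%N by rewrite card_ord.
  have := HC _ _ (@adj_sym _ G) (@adj_irr _ G) noK V0.
  rewrite -embeddings_lsum -num_copies_path ?card_ord; last by lia.
  have : C * n%:R ^+ k.+2 <= `|C| * n%:R ^+ k.+2 :> R.
    by rewrite ler_wpM2r ?exprn_ge0 ?ler_norm.
  have : 0 <= `|C| * n%:R ^+ k.+2 :> R by rewrite mulr_ge0 ?exprn_ge0.
  rewrite -muln2 natrM; move: ((num_copies _ _)%:R : R) => N.
  have -> : 8 * k.+2%:R * (n%:R / k.+2%:R) ^+ k.+3 = 2 * (4 * k.+2%:R * (n%:R / k.+2%:R) ^+ k.+3) :> R.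
    by ring.
  move: (4 * k.+2%:R * _) (`|C| * _) (C * _) => X Y Z; lra.
apply: (big_ind (fun m : nat => m%:R <= _ :> R)) => [|x y xr yr|G /asboolP]; last exact: main.
  apply: addr_ge0; last by apply: mulr_ge0 => //; exact: exprn_ge0.
  by apply: mulr_ge0; [exact: mulr_ge0|apply: exprn_ge0; exact: divr_ge0].
by rewrite /maxn; case: ifP.
Qed.

(** With [m + 1] the integral part of [n / l], the falling factorial differs from
    [(n / l) ^ l.+1] by O(n^l). *)
Lemma max_copies_lower l n : (2 <= l)%N -> (l <= n)%N ->
  4 * l%:R * (n%:R / l%:R) ^+ l.+1 -
    4 * l%:R * (l.+1%:R * l.+2%:R * l.+3%:R ^+ l) * n%:R ^+ l <=
  (max_planar_copies R n (path_graph (2 * l + 1)))%:R :> R.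
Proof.
move=> l2 ln; pose m := (n %/ l).-1.
have l0 : (0 < l)%N by lia.
have d0 : (0 < n %/ l)%N by rewrite divn_gt0.
have fits : (m.+1 * l <= n)%N by rewrite prednK // leq_divM.
apply: (@le_trans _ _ (4 * l * m ^_ l.+1)%:R); last first.
  rewrite ler_nat; apply: leq_trans (num_copies_blowup l2 fits) _.
  apply: (@leq_bigmax_cond _ _ (fun G => num_copies G _) (blowup n l)).
  by apply/asboolP; exact: blowup_planar.
apply: (@le_trans _ _ (4 * l%:R * (m - l)%:R ^+ l.+1)); last first.
  by rewrite -natrX -!natrM ler_nat leq_mul2l ffact_ge orbT.
have L0 : 0 < l%:R :> R by rewrite ltr0n.
rewrite -[_ * n%:R ^+ l]mulrA -mulrBr ler_pM2l ?mulr_gt0 // lerBlDr.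
have xy : n%:R / l%:R <= (m - l)%:R + l.+2%:R :> R.
  rewrite ler_pdivrMr // -natrD -natrM ler_nat.
  apply: (@leq_trans (m.+2 * l)); last by rewrite leq_mul2r; apply/orP; right; lia.
  rewrite /m prednK //; apply: ltnW; exact: ltn_ceil.
have yn : (m - l)%:R <= n%:R :> R.
  rewrite ler_nat; apply: leq_trans (leq_subr _ _) _; apply: leq_trans (leq_pred _) _.
  exact: leq_div.
have y0 : 0 <= (m - l)%:R :> R by [].
have n1 : 1 <= n%:R :> R by rewrite ler1n; lia.
have x0 : 0 <= n%:R / l%:R :> R by rewrite divr_ge0.
have c0 : 0 <= l.+2%:R :> R by [].
apply: (@le_trans _ _ (((m - l)%:R + l.+2%:R) ^+ l.+1)).
  by apply: lerXn2r; rewrite ?nnegrE // addr_ge0.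
apply: le_trans (exprD_le _ y0 c0) _; rewrite lerD2l -[leRHS]mulrA -exprMn.
apply: ler_wpM2l; first by rewrite mulr_ge0.
apply: lerXn2r; rewrite ?nnegrE; [exact: addr_ge0|exact: mulr_ge0|].
rewrite -[l.+3%:R]natr1 mulrDl mul1r addrC; apply: lerD => //.
by rewrite ler_peMr.
Qed.

End Conclusion.

Local Open Scope classical_set_scope.
Local Open Scope ring_scope.

Theorem theorem1p4 (R : realType) (l : nat) (hl : (2 <= l)%N) :
  (fun n : nat => (max_planar_copies R n (path_graph (2 * l + 1)%N))%:R : R^o) =
  (fun n : nat => 4 * l%:R * (n%:R / l%:R) ^+ l.+1 : R^o)
    +O_\oo (fun n : nat => n%:R ^+ l : R^o).
Proof.
have [C HC] := max_copies_upper R hl.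
pose C' : R := 4 * l%:R * (l.+1%:R * l.+2%:R * l.+3%:R ^+ l).
have C'0 : 0 <= C' by rewrite !mulr_ge0 ?exprn_ge0.
apply/eqaddOP/bigO_exP; exists (`|C| + C' + 1).
  by rewrite ltr_wpDl // addr_ge0.
exists l => // n /= ln.
have n0 : (0 < n)%N by apply: leq_trans ln; apply: leq_trans hl.
have := HC n n0; have := max_copies_lower R hl ln; rewrite -/C'.
rewrite !fctE [X in _ <= _ * X]ger0_norm ?exprn_ge0 // ler_norml.
have p0 : 0 <= n%:R ^+ l :> R by rewrite exprn_ge0.
have : C * n%:R ^+ l <= `|C| * n%:R ^+ l :> R by rewrite ler_wpM2r ?ler_norm.
have : 0 <= `|C| * n%:R ^+ l :> R by rewrite mulr_ge0.
have : 0 <= C' * n%:R ^+ l :> R by rewrite mulr_ge0.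
have -> : (`|C| + C' + 1) * n%:R ^+ l =
    `|C| * n%:R ^+ l + C' * n%:R ^+ l + n%:R ^+ l by ring.
move: p0; move: (`|C| * n%:R ^+ l) (C' * n%:R ^+ l) (C * n%:R ^+ l) (n%:R ^+ l : R).
move: (4 * l%:R * (n%:R / l%:R) ^+ l.+1 : R).
move: ((max_planar_copies R n (path_graph (2 * l + 1)))%:R : R) => M X cN c'N CN N.
by move=> p0 h1 h2 h3 h4 h5; apply/andP; split; lra.
Qed.
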